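(* Let $W$ be a simply laced Weyl group. Let $v,w\in W$ be such that $v\leq w$ and $\ell(v,w)=2$. Then there exist positive roots $\alpha,\gamma$ such that $\alpha\neq\gamma$ and such that $\partial_{w/v}=\partial_\alpha\partial_\gamma$.
   Context: Coxeter setup. $(W,S)$ is a Coxeter system with $W$ finite; $m(s,s')$ is the order of $ss'$. $\mathfrak h_{\mathbb R}$ is a real vector space with basis $\Delta$ (the simple roots), in bijection with $S$ via $\beta\mapsto s_\beta$, with symmetric bilinear form $B(\beta,\beta')=-\cos(\pi/m(s_\beta,s_{\beta'}))$. $W$ acts by $s_\beta(x)=x-2B(x,\beta)\beta$, and $B$ is a $W$-invariant scalar product. $R=\{u(\beta):u\in W,\beta\in\Delta\}$ is the root system, and the positive roots $R^+$ are the roots that are nonnegative linear combinations of $\Delta$. For $\alpha=u(\beta)\in R$, $s_\alpha=us_\beta u^{-1}$. $\ell$ is the length function, $\ell(v,w)=\ell(w)-\ell(v)$, $\leq$ the (strong) Bruhat order. A simply laced Weyl group is the Weyl group of a reduced irreducible crystallographic root system whose Dynkin diagram has only simple edges (types $\mathsf A_n,\mathsf D_n,\mathsf E_6,\mathsf E_7,\mathsf E_8$); equivalently $(W,S)$ is irreducible and all $m(s,s')\leq 3$, and the two root systems then agree (up to normalization of the scalar product). Products $\prod_{j\in J}$ over a finite set $J$ of integers are taken in increasing order of the index (empty product $=1$). Coinvariant algebra and operators. $\mathfrak h=\mathfrak h_{\mathbb R}\otimes\mathbb C$, $S(\mathfrak h)$ is the symmetric algebra with its $W$-action, $I_W$ the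 ideal generated by the $W$-invariant polynomials without constant term, and $S_W=S(\mathfrak h)/I_W$. For $\alpha\in R$, $\partial_\alpha=\frac{1-s_\alpha}{\alpha}$ is the $\mathbb C$-linear endomorphism of $S_W$ induced by $f\mapsto (f-s_\alpha f)/\alpha$ on $S(\mathfrak h)$. Skew divided difference operators: for $v\leq w$, fix a reduced expression $s_{\gamma_1}\cdots s_{\gamma_k}$ of $w$; for $J\subseteq\{1,\ldots,k\}$ let $\partial_J=\delta_1\cdots\delta_k$, where $\delta_j=s_{\gamma_j}$ (acting on $S_W$) if $j\in J$ and $\delta_j=\partial_{\gamma_j}$ if $j\notin J$; then $\partial_{w/v}=v^{-1}\sum_J\partial_J$, the sum over all $J$ such that $\prod_{j\in J}s_{\gamma_j}$ is a reduced expression of $v$ (independent of the reduced expression of $w$). *)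

(* Defs.v *)
From HB Require Import structures.
From mathcomp Require Import all_boot all_order all_algebra all_fingroup all_character.
From mathcomp Require Import boolp classical_sets reals trigo complex.
From mathcomp Require Import mpoly generic_quotient ring_quotient.
Set Implicit Arguments.
Unset Strict Implicit.
Unset Printing Implicit Defensive.
Import Order.TTheory GRing.Theory Num.Theory.
Local Open Scope ring_scope.
Local Open Scope quotient_scope.

(* A finite Coxeter system (W, S) of rank n: W is the whole group gT and S is
   enumerated without repetition by cox_gen.  The last field is the universal
   property of the presentation W = < S | (ss')^m(s,s') = 1 >; it ranges over
   arbitrary, possibly infinite, groups G. *)
Record coxeter_system (gT : finGroupType) (n : nat) := CoxeterSystem {
  cox_gen :> 'I_n -> gT;
  cox_gen_inj : injective cox_gen;
  cox_gen_order : forall i, #[cox_gen i]%g = 2%N;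
  cox_gen_generates : <<[set cox_gen i | i : 'I_n]>>%g = [set: gT];
  cox_presentation : forall (G : groupType) (f : 'I_n -> G),
    (forall i j, ((f i * f j) ^+ #[(cox_gen i * cox_gen j)%g]%g = 1)%g) ->
    exists phi : gT -> G,
      {morph phi : x y / (x * y)%g} /\ (forall i, phi (cox_gen i) = f i)
}.

Section Coxeter.
Variables (gT : finGroupType) (n : nat) (S : coxeter_system gT n).

Definition cox_m (i j : 'I_n) : nat := #[S i * S j]%g.

(* Coxeter graph connected (and nonempty). *)
Definition cox_irreducible : Prop :=
  (0 < n)%N /\ forall i j : 'I_n, connect [rel a b | (2 < cox_m a b)%N] i j.

(* Weyl groups of types A_n, D_n, E_6, E_7, E_8. *)
Definition simply_laced_weyl : Prop :=
  cox_irreducible /\ forall i j : 'I_n, (cox_m i j <= 3)%N.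

Definition word_eval (t : seq 'I_n) : gT := (\prod_(i <- t) S i)%g.

Definition has_word (u : gT) (k : nat) : bool :=
  [exists t : k.-tuple 'I_n, word_eval t == u].

Lemma has_word_ex (u : gT) : exists k, has_word u k.
Proof.
have : u \in <<[set S i | i : 'I_n]>>%g by rewrite cox_gen_generates inE.
case/gen_prodgP=> k [c cS ->]; exists k; apply/existsP.
have cS' j : exists i, c j == S i.
  by have /imsetP[i _ ->] := cS j; exists i.
exists [tuple xchoose (cS' j) | j < k]; rewrite /word_eval big_tuple.
by apply/eqP/eq_bigr => j _; rewrite tnth_mktuple -(eqP (xchooseP (cS' j))).
Qed.

Definition cox_len (u : gT) : nat := ex_minn (has_word_ex u).

Lemma redexpr_ex (u : gT) :
  exists t : (cox_len u).-tuple 'I_n, word_eval t == u.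
Proof. by apply/existsP; rewrite /cox_len; case: ex_minnP. Qed.

(* A fixed reduced expression of u. *)
Definition redexpr (u : gT) : (cox_len u).-tuple 'I_n := xchoose (redexpr_ex u).

Definition is_reflection (t : gT) : bool :=
  [exists ui : gT * 'I_n, t == (ui.1 * S ui.2 * ui.1^-1)%g].

Definition bruhat : rel gT :=
  connect [rel x y | [exists t, is_reflection t && (y == (x * t)%g)]
                     && (cox_len x < cox_len y)%N].

End Coxeter.

Section Geometric.
Variables (gT : finGroupType) (n : nat) (S : coxeter_system gT n) (R : realType).

(* h_R is identified with 'cV[R]_n through the basis of simple roots. *)
Definition simple_root (i : 'I_n) : 'cV[R]_n := delta_mx i ord0.

Definition cox_form (x y : 'cV[R]_n) : R :=
  \sum_i \sum_j x i ord0 * y j ord0 * - cos (trigo.pi / (cox_m S i j)%:R).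

(* With column vectors, rho u *m x is a left action of W. *)
Definition geometric_rep (rho : mx_representation R [set: gT] n) : Prop :=
  forall (i : 'I_n) (x : 'cV[R]_n),
    rho (S i) *m x = x - (2 * cox_form x (simple_root i)) *: simple_root i.

Variable rho : mx_representation R [set: gT] n.

Definition is_root (alpha : 'cV[R]_n) : Prop :=
  exists (u : gT) (i : 'I_n), alpha = rho u *m simple_root i.

Definition pos_root (alpha : 'cV[R]_n) : Prop :=
  is_root alpha /\ forall i, 0 <= alpha i ord0.

(* s_alpha = u s_beta u^-1 for alpha = u(beta), beta simple; the value is 1 when
   alpha is not a root. *)
Definition root_refl (alpha : 'cV[R]_n) : gT :=
  if [pick ui : gT * 'I_n | alpha == rho ui.1 *m simple_root ui.2] is Some ui
  then (ui.1 * S ui.2 * ui.1^-1)%g else 1%g.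

End Geometric.

Section Coinvariant.
Variables (gT : finGroupType) (n : nat) (R : realType).
Variable rho : mx_representation R [set: gT] n.

(* S(h) is {mpoly R[i][n]}: the variable 'X_i is the i-th simple root, and
   linform embeds h_R in S(h). *)
Definition linform (x : 'cV[R]_n) : {mpoly R[i][n]} :=
  \sum_(i < n) (x i ord0)%:C%C *: 'X_i.

Definition sym_act (u : gT) (f : {mpoly R[i][n]}) : {mpoly R[i][n]} :=
  f \mPo [tuple linform (rho u *m simple_root R i) | i < n].

Definition sym_invariant (f : {mpoly R[i][n]}) : Prop :=
  forall u : gT, sym_act u f = f.

Definition inv_ideal_prop (f : {mpoly R[i][n]}) : Prop :=
  exists (m : nat) (g h : 'I_m -> {mpoly R[i][n]}),
    (forall k, sym_invariant (h k) /\ (h k)@_0%MM = 0) /\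
    f = \sum_(k < m) g k * h k.

Definition inv_ideal : {pred {mpoly R[i][n]}} :=
  fun f => `[< inv_ideal_prop f >].

Lemma inv_ideal_closed : idealr_closed inv_ideal.
Proof.
split.
- apply/asboolP; exists 0%N, (fun=> 0), (fun=> 0); split; first by case.
  by rewrite big_ord0.
- apply/negP => /asboolP[m [g [h [hh e]]]].
  have := congr1 (fun p : {mpoly R[i][n]} => p@_0%MM) e.
  rewrite /= raddf_sum /= mcoeff1 eqxx big1 => [/eqP|k _]; first by rewrite oner_eq0.
  by rewrite rmorphM /= (hh k).2 mulr0.
- move=> a u v /asboolP[m [g [h [hh ->]]]] /asboolP[m' [g' [h' [hh' ->]]]].
  apply/asboolP; exists (m + m')%N.
  exists (fun k => match split k with inl i => a * g i | inr j => g' j end).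
  exists (fun k => match split k with inl i => h i | inr j => h' j end).
  split; first by move=> k; case: split.
  rewrite big_split_ord mulr_sumr; congr (_ + _); apply: eq_bigr => i _.
    by rewrite -[lshift _ _]/(unsplit (inl i)) unsplitK mulrA.
  by rewrite -[rshift _ _]/(unsplit (inr i)) unsplitK.
Qed.

HB.instance Definition _ := isIdealr.Build {mpoly R[i][n]} inv_ideal inv_ideal_closed.


End Coinvariant.

(* S_W = S(h) / I_W *)
Notation coinv rho := {ideal_quot (inv_ideal rho)}.

Section Operators.
Variables (gT : finGroupType) (n : nat) (S : coxeter_system gT n) (R : realType).
Variable rho : mx_representation R [set: gT] n.

(* (f - s_alpha f) / alpha in S(h), as the g with alpha g = f - s_alpha f. *)
Definition divdiff (alpha : 'cV[R]_n) (f : {mpoly R[i][n]}) : {mpoly R[i][n]} :=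
  xget 0 [set g | linform alpha * g = f - sym_act rho (root_refl S rho alpha) f]%classic.

(* The induced operators on S_W are computed on the canonical representative;
   coinv_act_pi and coinv_dd_pi below show independence of that choice. *)
Definition coinv_act (u : gT) (x : coinv rho) : coinv rho :=
  \pi_(coinv rho) (sym_act rho u (repr x)).

Definition coinv_dd (alpha : 'cV[R]_n) (x : coinv rho) : coinv rho :=
  \pi_(coinv rho) (divdiff alpha (repr x)).

(* The operator partial_J for the expression t; J is a set of positions in t,
   counted from 0. *)
Definition dd_word (k : nat) (t : k.-tuple 'I_n) (J : {set 'I_k}) :
    coinv rho -> coinv rho :=
  \big[(fun f g => f \o g) / id]_(j < k)
    (if j \in J then coinv_act (S (tnth t j))
     else coinv_dd (simple_root R (tnth t j))).

(* partial_{w/v}; J selects a reduced expression of v when its product is v and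
   its size is the length of v. *)
Definition skew_dd (v w : gT) (x : coinv rho) : coinv rho :=
  let t := redexpr S w in
  coinv_act v^-1%g
    (\sum_(J : {set 'I_(cox_len S w)} |
             ((\prod_(j in J) S (tnth t j))%g == v) && (#|J| == cox_len S v))
       dd_word t J x).

Lemma sym_actB u : {morph sym_act rho u : f g / f - g}.
Proof. by move=> f g; rewrite /sym_act raddfB. Qed.

Lemma sym_actM u : {morph sym_act rho u : f g / f * g}.
Proof. by move=> f g; rewrite /sym_act rmorphM. Qed.

Lemma sym_act_ideal u f : f \in inv_ideal rho -> sym_act rho u f \in inv_ideal rho.
Proof.
move=> /asboolP[m [g [h [hh ->]]]]; apply/asboolP.
exists m, (fun k => sym_act rho u (g k)), h; split=> //.
rewrite /sym_act raddf_sum; apply: eq_bigr => k _.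
by rewrite [LHS]sym_actM (hh k).1.
Qed.

Lemma pi_eqP (f g : {mpoly R[i][n]}) :
  (\pi_(coinv rho) f = \pi_(coinv rho) g) <-> (f - g \in inv_ideal rho).
Proof. by rewrite Quotient.idealrBE; split => /eqP. Qed.

Lemma coinv_act_pi u f :
  coinv_act u (\pi_(coinv rho) f) = \pi_(coinv rho) (sym_act rho u f).
Proof.
apply/pi_eqP; rewrite -sym_actB; apply: sym_act_ideal.
by apply/pi_eqP; rewrite reprK.
Qed.

Lemma linformD (x y : 'cV[R]_n) : linform (x + y) = linform x + linform y.
Proof.
by rewrite -big_split; apply: eq_bigr => i _; rewrite mxE rmorphD scalerDl.
Qed.

Lemma linformZ (a : R) (x : 'cV[R]_n) : linform (a *: x) = a%:C%C *: linform x.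
Proof.
by rewrite /linform scaler_sumr; apply: eq_bigr => i _; rewrite mxE rmorphM scalerA.
Qed.

Lemma linform_simple (i : 'I_n) : linform (simple_root R i) = 'X_i.
Proof.
rewrite /linform (bigD1 i) //= mxE !eqxx scale1r big1 ?addr0 // => j /negPf ji.
by rewrite mxE ji scale0r.
Qed.

Lemma linform_coef (x : 'cV[R]_n) (i : 'I_n) : (linform x)@_U_(i)%MM = (x i ord0)%:C%C.
Proof.
rewrite /linform raddf_sum (bigD1 i) //= mcoeffZ mcoeffXU eqxx mulr1 big1 ?addr0 //.
by move=> j /negPf ji; rewrite mcoeffZ mcoeffXU ji mulr0.
Qed.

Lemma linform_eq0 (x : 'cV[R]_n) : linform x = 0 -> x = 0.
Proof.
move=> x0; apply/matrixP => i j; rewrite ord1 mxE.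
by have := linform_coef x i; rewrite x0 mcoeff0 => /esym[].
Qed.

Lemma is_root_neq0 alpha : is_root rho alpha -> alpha != 0.
Proof.
move=> [u [i ->]]; apply/negP => /eqP /(congr1 (mulmx (rho u^-1%g))).
rewrite mulmx0 mulmxA -repr_mxM ?inE // mulVg repr_mx1 mul1mx => /matrixP/(_ i ord0).
by rewrite !mxE !eqxx => /eqP; rewrite oner_eq0.
Qed.

Lemma root_refl_act alpha x : geometric_rep S rho -> is_root rho alpha ->
  exists c : R, rho (root_refl S rho alpha) *m x = x - c *: alpha.
Proof.
move=> geo [u [i aE]]; rewrite /root_refl; case: pickP => [[u' j] /= /eqP a'E|/(_ (u, i))].
  exists (2 * cox_form S (rho u'^-1%g *m x) (simple_root R j)).
  rewrite !repr_mxM ?inE // -!mulmxA geo mulmxBr -scalemxAr -a'E.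
  by rewrite mulmxA -repr_mxM ?inE // mulgV repr_mx1 mul1mx.
by rewrite /= aE eqxx.
Qed.

Lemma divdiff_ex alpha f : geometric_rep S rho -> is_root rho alpha ->
  exists g, linform alpha * g = f - sym_act rho (root_refl S rho alpha) f.
Proof.
move=> geo ra; set s := root_refl _ _ _.
have XP i : exists g, linform alpha * g = 'X_i - sym_act rho s 'X_i.
  rewrite /sym_act comp_mpolyXU -tnth_nth tnth_mktuple.
  have [c ->] := root_refl_act (simple_root R i) geo ra.
  exists (c%:C%C)%:MP.
  rewrite linformD linform_simple -scaleNr linformZ rmorphN scaleNr.
  by rewrite opprB addrC subrK mulrC mul_mpolyC.
have MP p q : (exists g, linform alpha * g = p - sym_act rho s p) ->
    (exists g, linform alpha * g = q - sym_act rho s q) ->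
    exists g, linform alpha * g = p * q - sym_act rho s (p * q).
  move=> [g gE] [h hE]; exists (g * q + sym_act rho s p * h).
  rewrite mulrDr mulrA gE mulrCA hE mulrBl mulrBr sym_actM addrA subrK //.
have CP (c : R[i]) : exists g, linform alpha * g = c%:MP - sym_act rho s c%:MP.
  by exists 0; rewrite /sym_act comp_mpolyC subrr mulr0.
elim/mpolyind: f => [|c m p _ _ [g gE]]; first by rewrite -mpolyC0; apply: CP.
have [h hE] : exists h, linform alpha * h = c *: 'X_[m] - sym_act rho s (c *: 'X_[m]).
  rewrite -mul_mpolyC; apply: (MP) => //; rewrite mpolyXE_id.
  elim/big_ind: _ => // [|i _]; first by rewrite -mpolyC1; apply: CP.
  elim: (m i) => [|k IH]; first by rewrite expr0 -mpolyC1; apply: CP.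
  by rewrite exprS; apply: (MP _ _ (XP i) IH).
exists (h + g); rewrite mulrDr hE gE [LHS]addrACA -opprD; congr (_ - _).
exact/esym/raddfD.
Qed.

Lemma divdiffE alpha f : geometric_rep S rho -> is_root rho alpha ->
  linform alpha * divdiff alpha f = f - sym_act rho (root_refl S rho alpha) f.
Proof.
move=> geo ra; have [g gE] := divdiff_ex f geo ra.
by rewrite /divdiff; case: xgetP => [h _ //|/(_ g)]; case.
Qed.

Lemma linform_inj alpha : is_root rho alpha -> injective ( *%R (linform alpha)).
Proof.
move=> ra; apply: mulfI; apply: contra (is_root_neq0 ra) => /eqP /linform_eq0 ->.
exact: eqxx.
Qed.

Lemma divdiff_ideal alpha f : geometric_rep S rho -> is_root rho alpha ->
  f \in inv_ideal rho -> divdiff alpha f \in inv_ideal rho.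
Proof.
move=> geo ra /asboolP[m [g [h [hh fE]]]]; apply/asboolP.
exists m, (fun k => divdiff alpha (g k)), h; split=> //.
apply: (linform_inj ra); rewrite divdiffE // fE mulr_sumr [sym_act _ _ _]raddf_sum -sumrB.
apply: eq_bigr => k _; rewrite mulrA divdiffE // mulrBl; congr (_ - _).
by rewrite [LHS]sym_actM (hh k).1.
Qed.

Lemma divdiffB alpha f g : geometric_rep S rho -> is_root rho alpha ->
  divdiff alpha (f - g) = divdiff alpha f - divdiff alpha g.
Proof.
move=> geo ra; have E h := divdiffE h geo ra; apply: (linform_inj ra).
have aux (L a b c sf sg sfg : {mpoly R[i][n]}) : L * a = f - sf -> L * b = g - sg ->
    L * c = f - g - sfg -> sfg = sf - sg -> L * c = L * (a - b).
  by move=> ha hb -> ->; rewrite mulrBr ha hb opprD [LHS]addrACA -opprD.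
exact: aux (E f) (E g) (E (f - g)) (sym_actB _ f g).
Qed.

Lemma coinv_dd_pi alpha f : geometric_rep S rho -> is_root rho alpha ->
  coinv_dd alpha (\pi_(coinv rho) f) = \pi_(coinv rho) (divdiff alpha f).
Proof.
move=> geo ra; apply/pi_eqP; rewrite -divdiffB //; apply: divdiff_ideal => //.
by apply/pi_eqP; rewrite reprK.
Qed.

End Operators.

(* Main.v *)
Require Import Defs.
From mathcomp Require Import all_boot all_order all_algebra all_fingroup all_character.
From mathcomp Require Import boolp classical_sets reals trigo complex.
From mathcomp Require Import mpoly generic_quotient ring_quotient.
From mathcomp Require Import zify ring lra.
Set Implicit Arguments.
Unset Strict Implicit.
Unset Printing Implicit Defensive.
Import Order.TTheory GRing.Theory Num.Theory.
Local Open Scope ring_scope.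
Local Open Scope quotient_scope.

(** Write l = s_1 ... s_k for the chosen reduced word of w, and let beta_m be the
    m-th inversion of w read off from l, that is
    beta_m = (s_(m+1) ... s_k)^-1 (alpha_m) with alpha_m the simple root of the
    m-th letter, and t_m the reflection in beta_m. The positive roots sent to
    negative ones by w are exactly the beta_m, and w t_m is l with its m-th letter
    erased; erasing the letters p < q gives w t_p t_q (omit2_eval).

    Moving all group elements of a word to the left of the divided differences by
    u d_a u^-1 = d_(u a) turns the definition into
      skew(w, v) = sum over p < q with w t_p t_q = v of d_(t_q beta_p) d_(beta_q).
    At least one pair occurs, by two applications of strong exchange along a
    Bruhat chain (bruhat_omit2). The pairs all have the same product t_p t_q, and
    such a product of two reflections determines the plane spanned by the two
    roots (refl_product_plane). In the simply laced case two roots a <> +-b satisfy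
    2 B(a, b) = 0, 1 or -1, so this plane contains two or three positive roots, and
    the convexity of the enumeration beta_1, ..., beta_k (a root that is the sum of
    two others stands between them, inv_root_between) leaves two possibilities
    (pairs_dichotomy).

    - There is one pair (p, q), and t_q beta_p is positive. The sum is the single
      term d_(t_q beta_p) d_(beta_q).
    - There are three inversions b_1, b_2 = b_1 + b_3, b_3 at positions p < q < r,
      and the pairs are (p, q) and (q, r). The sum is d_(-b_3) d_(b_2) + d_(b_1) d_(b_3),
      and the quadratic relation of divided differences in rank two
      (divdiff_relation) collapses it to d_(b_2) d_(b_1).

    The facts about roots that this needs are proved here for the given geometric
    representation: every root is positive or negative, as follows from
    w alpha_i >= 0 whenever l(w s_i) >= l(w) (nonneg_of_len), and 2 B(a, b) is an
    integer of absolute value less than 2, which uses the finiteness of W through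
    an averaged scalar product (root_pair_cases). *)

(** * Length and reduced words *)

Section Length.
Variables (gT : finGroupType) (n : nat) (S : coxeter_system gT n).
Local Notation len := (cox_len S).
Local Notation eval := (word_eval S).
Implicit Types (u x y t : gT) (i j : 'I_n) (l : seq 'I_n).

Lemma gen_mulgg i : (S i * S i = 1)%g.
Proof. by have := expg_order (S i); rewrite cox_gen_order. Qed.

Lemma gen_invg i : ((S i)^-1 = S i)%g.
Proof. by apply/eqP; rewrite eq_invg_mul gen_mulgg. Qed.

Lemma word_eval_nil : eval [::] = 1%g.
Proof. exact: big_nil. Qed.

Lemma word_eval_cons i l : eval (i :: l) = (S i * eval l)%g.
Proof. exact: big_cons. Qed.

Lemma word_eval_cat l1 l2 : eval (l1 ++ l2) = (eval l1 * eval l2)%g.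
Proof. exact: big_cat. Qed.

Lemma word_eval_rev l : eval (rev l) = (eval l)^-1%g.
Proof.
elim: l => [|i l IH]; first by rewrite word_eval_nil invg1.
by rewrite rev_cons -cats1 word_eval_cat IH !word_eval_cons word_eval_nil mulg1
  invMg gen_invg.
Qed.

Lemma len_word_le l : (len (eval l) <= size l)%N.
Proof.
rewrite /cox_len; case: ex_minnP => m _; apply.
by apply/existsP; exists (in_tuple l).
Qed.

Lemma reduced_word u : exists2 l, eval l = u & size l = len u.
Proof. by have [t /eqP tE] := redexpr_ex S u; exists t; rewrite ?size_tuple. Qed.

Lemma lenM_le x y : (len (x * y)%g <= len x + len y)%N.
Proof.
have [l <- <-] := reduced_word x; have [l' <- <-] := reduced_word y.
by rewrite -word_eval_cat -size_cat len_word_le.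
Qed.

Lemma lenV x : len x^-1%g = len x.
Proof.
have H y : (len y^-1%g <= len y)%N.
  have [l <- <-] := reduced_word y.
  by rewrite -word_eval_rev -(size_rev l) len_word_le.
by apply/eqP; rewrite eqn_leq H -{1}[x]invgK H.
Qed.

Lemma len_gen i : (len (S i) <= 1)%N.
Proof. by have := len_word_le [:: i]; rewrite word_eval_cons word_eval_nil mulg1. Qed.

Lemma lenMgen x i : (len (x * S i)%g <= (len x).+1)%N.
Proof.
by rewrite -addn1; apply: leq_trans (lenM_le _ _) _; rewrite leq_add2l len_gen.
Qed.

Lemma descent_ex x : x != 1%g -> exists i, (len (x * S i)%g < len x)%N.
Proof.
have [l xE <-] := reduced_word x; rewrite -xE.
case/lastP: l {xE} => [|l i]; first by rewrite word_eval_nil eqxx.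
move=> _; exists i; rewrite size_rcons ltnS -cats1 word_eval_cat.
by rewrite word_eval_cons word_eval_nil mulg1 -mulgA gen_mulgg mulg1 len_word_le.
Qed.

Definition reduced l := len (eval l) == size l.

Lemma reduced_cat l1 l2 : reduced (l1 ++ l2) -> reduced l1 /\ reduced l2.
Proof.
rewrite /reduced word_eval_cat size_cat => /eqP E.
have := lenM_le (eval l1) (eval l2); rewrite E.
have := len_word_le l1; have := len_word_le l2.
by move=> *; split; apply/eqP; lia.
Qed.

(** The sign character exists because the constant map to a transposition
    respects every relation of the presentation. *)
Lemma word_sgn : exists sg : gT -> {perm bool},
  {morph sg : x y / (x * y)%g} /\ forall i, sg (S i) = tperm true false.
Proof.
by apply: (cox_presentation (G := {perm bool})) => i j; rewrite tperm2 expg1n.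
Qed.

Lemma len_parity t x : is_reflection S t -> odd (len (x * t)%g) = ~~ odd (len x).
Proof.
(* A reflection is conjugate to a generator, so the sign character sends it to the
   transposition; the sign of x is the parity of its length. *)
have [sg [sgM sgS]] := word_sgn.
have sg1 : sg 1%g = 1%g by apply: (mulgI (sg 1%g)); rewrite -sgM !mulg1.
have sgE y : sg y = if odd (len y) then tperm true false else 1%g.
  have [l <- <-] := reduced_word y; elim: l => [|i l IH]; first by rewrite word_eval_nil sg1.
  by rewrite word_eval_cons sgM sgS IH /=; case: (odd _); rewrite /= ?tperm2 ?mulg1.
case/existsP=> -[u i] /= /eqP->.
have := sgM x (u * S i * u^-1)%g.
have -> : sg (u * S i * u^-1)%g = tperm true false.
  rewrite !sgM sgS; have /eqP := sgM u u^-1%g; rewrite mulgV sg1 eq_sym -eq_invg_mul => /eqP<-.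
  rewrite sgE; case: (odd _); last by rewrite mul1g invg1 mulg1.
  by rewrite tperm2 mul1g tpermV.
have nt : tperm true false != 1%g.
  by apply/eqP => /(congr1 (fun s : {perm bool} => s true)); rewrite tpermL perm1.
rewrite !sgE; case: (odd (len x)); case: (odd (len _)) => //=; rewrite ?tperm2 ?mul1g.
- by move/eqP; rewrite (negPf nt).
- by move/eqP; rewrite eq_sym (negPf nt).
Qed.

End Length.

(** * The geometric representation *)

(** With c = cos (pi/3), the double angle formula and cos (2 pi/3) = - c give
    (2 c - 1) (c + 1) = 0. *)
Lemma cos_pi_third (R : realType) : cos (trigo.pi / 3) = 1 / 2 :> R.
Proof.
set x := trigo.pi / 3.
have pi0 := trigo.pi_gt0 R.
have c0 : 0 < cos x by apply: cos_gt0_pihalf; apply/andP; split; rewrite /x; lra.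
have E : cos (x *+ 2) = - cos x.
  have -> : x *+ 2 = - x + trigo.pi by rewrite /x; lra.
  by rewrite cosDpi cosN.
move: E; rewrite cos_mulr2n => E.
have : (2 * cos x - 1) * (cos x + 1) = 0 by move: E; rewrite expr2 mulr2n => E; lra.
by move/eqP; rewrite mulf_eq0 => /orP[] /eqP ?; lra.
Qed.

Section Geometry.
Variables (gT : finGroupType) (n : nat) (S : coxeter_system gT n).
Variables (R : realType) (rho : mx_representation R [set: gT] n).
Hypothesis geo : geometric_rep S rho.
Hypothesis m3 : forall i j : 'I_n, (cox_m S i j <= 3)%N.
Local Notation len := (cox_len S).
Local Notation eval := (word_eval S).
Local Notation B := (cox_form S).
Local Notation e := (simple_root R).
Implicit Types (u v w t : gT) (i j : 'I_n) (l : seq 'I_n) (x y a b c d : 'cV[R]_n).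

Lemma rhoM u v x : rho (u * v)%g *m x = rho u *m (rho v *m x).
Proof. by rewrite repr_mxM ?inE // mulmxA. Qed.

Lemma rho1 x : rho 1%g *m x = x.
Proof. by rewrite repr_mx1 mul1mx. Qed.

Lemma rhoK u : cancel (mulmx (rho u) : 'cV_n -> _) (mulmx (rho u^-1%g)).
Proof. by move=> x; rewrite -rhoM mulVg rho1. Qed.

Lemma rhoKV u : cancel (mulmx (rho u^-1%g) : 'cV_n -> _) (mulmx (rho u)).
Proof. by move=> x; rewrite -rhoM mulgV rho1. Qed.

Lemma cox_m_sym i j : cox_m S i j = cox_m S j i.
Proof. by rewrite /cox_m -orderV invMg !gen_invg. Qed.

Lemma cox_formC x y : B x y = B y x.
Proof.
rewrite /cox_form exchange_big; apply: eq_bigr => i _; apply: eq_bigr => j _.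
by rewrite cox_m_sym; congr (_ * _); apply: mulrC.
Qed.

Lemma cox_formDl x y z : B (x + y) z = B x z + B y z.
Proof.
rewrite /cox_form -big_split; apply: eq_bigr => i _.
rewrite -big_split; apply: eq_bigr => j _ /=.
by rewrite mxE !mulrDl.
Qed.

Lemma cox_formZl k x y : B (k *: x) y = k * B x y.
Proof.
rewrite /cox_form mulr_sumr; apply: eq_bigr => i _.
rewrite mulr_sumr; apply: eq_bigr => j _ /=.
by rewrite mxE !mulrA.
Qed.

Lemma cox_formNl x y : B (- x) y = - B x y.
Proof. by rewrite -scaleN1r cox_formZl mulN1r. Qed.

Lemma cox_formBl x y z : B (x - y) z = B x z - B y z.
Proof. by rewrite cox_formDl cox_formNl. Qed.

Lemma cox_formDr x y z : B x (y + z) = B x y + B x z.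
Proof. by rewrite cox_formC cox_formDl !(cox_formC x). Qed.

Lemma cox_formZr k x y : B x (k *: y) = k * B x y.
Proof. by rewrite cox_formC cox_formZl cox_formC. Qed.

Lemma cox_formNr x y : B x (- y) = - B x y.
Proof. by rewrite cox_formC cox_formNl cox_formC. Qed.

Lemma cox_formBr x y z : B x (y - z) = B x y - B x z.
Proof. by rewrite cox_formDr cox_formNr. Qed.

Lemma cox_form_simple i j : B (e i) (e j) = - cos (trigo.pi / (cox_m S i j)%:R).
Proof.
rewrite /cox_form (bigD1 i) //= [X in _ + X]big1 ?addr0 => [|k /negPf ki].
  rewrite (bigD1 j) //= [X in _ + X]big1 ?addr0 => [|k /negPf kj].
    by rewrite !mxE !eqxx !mul1r.
  by rewrite !mxE kj !(mulr0, mul0r).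
by rewrite big1 // => k' _; rewrite mxE ki !mul0r.
Qed.

Lemma cox_form_simple1 i : B (e i) (e i) = 1.
Proof. by rewrite cox_form_simple /cox_m gen_mulgg order1 divr1 cospi opprK. Qed.

Lemma cox_m_2_or_3 i j : i != j -> cox_m S i j = 2%N \/ cox_m S i j = 3%N.
Proof.
move=> ij; have := m3 i j; have : (0 < cox_m S i j)%N by apply: order_gt0.
have : cox_m S i j <> 1%N.
  move/eqP; rewrite order_eq1 -eq_invg_mul gen_invg => /eqP/cox_gen_inj/eqP.
  by rewrite (negPf ij).
by case: (cox_m S i j) => [|[|[|[|m]]]] //; [left|right].
Qed.

Lemma cox_form_simple_m2 i j : cox_m S i j = 2%N -> B (e i) (e j) = 0.
Proof. by move=> ijE; rewrite cox_form_simple ijE cos_pihalf oppr0. Qed.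

Lemma cox_form_simple_m3 i j : cox_m S i j = 3%N -> B (e i) (e j) = - (1 / 2).
Proof. by move=> ijE; rewrite cox_form_simple ijE cos_pi_third. Qed.

Lemma cox_form_refl a x y : B a a = 1 ->
  B (x - (2 * B x a) *: a) (y - (2 * B y a) *: a) = B x y.
Proof.
by move=> aa; rewrite !(cox_formBl, cox_formBr, cox_formZl, cox_formZr) aa (cox_formC a y); ring.
Qed.

Lemma cox_form_rho u x y : B (rho u *m x) (rho u *m y) = B x y.
Proof.
have [l <- _] := reduced_word S u; elim: l x y => [|i l IH] x y.
  by rewrite word_eval_nil !rho1.
by rewrite word_eval_cons !rhoM !geo cox_form_refl ?cox_form_simple1 // IH.
Qed.

Definition nonneg x := forall i, 0 <= x i ord0.

Lemma nonneg0 x : nonneg x -> nonneg (- x) -> x = 0.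
Proof.
move=> x0 x1; apply/matrixP => i j; rewrite ord1 mxE; apply/eqP.
by rewrite eq_le x0 andbT; have := x1 i; rewrite mxE oppr_ge0.
Qed.

Lemma nonnegD x y : nonneg x -> nonneg y -> nonneg (x + y).
Proof. by move=> x0 y0 i; rewrite mxE addr_ge0. Qed.

Lemma nonneg_simple i : nonneg (e i).
Proof. by move=> j; rewrite mxE ler0n. Qed.

Lemma is_root_simple i : is_root rho (e i).
Proof. by exists 1%g, i; rewrite rho1. Qed.

Lemma is_root_rho u a : is_root rho a -> is_root rho (rho u *m a).
Proof. by move=> [v [i ->]]; exists (u * v)%g, i; rewrite rhoM. Qed.

Lemma rho_simple i : rho (S i) *m e i = - e i.
Proof. by rewrite geo cox_form_simple1 mulr1 scaler_nat mulr2n opprD addNKr. Qed.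

Lemma is_rootN a : is_root rho a -> is_root rho (- a).
Proof. by move=> [u [i ->]]; exists (u * S i)%g, i; rewrite rhoM rho_simple mulmxN. Qed.

Lemma cox_form_root a : is_root rho a -> B a a = 1.
Proof. by move=> [u [i ->]]; rewrite cox_form_rho cox_form_simple1. Qed.

(** Induction on the length of u = v s_j. Since m(i, j) is 2 or 3, the dihedral
    subgroup generated by s_i and s_j is small enough to go through its elements by
    hand: u alpha_i is v alpha_i, or v alpha_i + v alpha_j, or z alpha_j
    when v = z s_i with z shorter than v, and in each case the induction hypothesis
    applies to a shorter element because otherwise u s_i would be too short. *)
Lemma nonneg_of_len u i : (len u <= len (u * S i)%g)%N -> nonneg (rho u *m e i).
Proof.
have [k ] := ubnP (len u); elim: k u i => // k IH u i.
rewrite ltnS => uk ui.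
have [->|u1] := eqVneq u 1%g; first by rewrite rho1; apply: nonneg_simple.
have [j uj] := descent_ex S u1.
have ij : i != j.
  by apply: contraTneq uj => <-; rewrite -leqNgt.
have [v vE] : exists v, v = (u * S j)%g by exists (u * S j)%g.
have uE : u = (v * S j)%g by rewrite vE -mulgA gen_mulgg mulg1.
have vk : (len v < k)%N by rewrite vE; exact: leq_trans uj uk.
have vj : (len v <= len (v * S j)%g)%N by rewrite -uE vE ltnW.
have ivj := IH v j vk vj.
have lenu : len u = (len v).+1.
  by apply/eqP; rewrite eqn_leq {1}uE lenMgen /= vE.
rewrite {1}uE rhoM geo.
have [m2|m3'] := cox_m_2_or_3 ij.
  rewrite cox_form_simple_m2 // mulr0 scale0r subr0; apply: IH => //.
  rewrite leqNgt; apply: contraTN ui => vi; rewrite -ltnNge.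
  have -> : (u * S i = v * S i * S j)%g.
    have := expg_order (S i * S j)%g; rewrite -/(cox_m S i j) m2 expgS expg1 => C.
    rewrite uE -!mulgA; congr mulg; rewrite -[in LHS](gen_invg _ i) -[in LHS](gen_invg _ j).
    by rewrite -invMg; apply/eqP; rewrite eq_invg_mul C.
  by apply: leq_ltn_trans (lenMgen _ _ _) _; rewrite lenu ltnS.
rewrite cox_form_simple_m3 //.
have -> : e i - (2 * - (1 / 2)) *: e j = e i + e j.
  by rewrite -scaleNr -[RHS]/(_ + _) -[in RHS](scale1r (e j)); congr (_ + _ *: _); lra.
rewrite mulmxDr.
have [vi|vi] := leqP (len v) (len (v * S i)%g).
  by apply: nonnegD => //; apply: IH.
have [z zE] : exists z, z = (v * S i)%g by exists (v * S i)%g.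
have vzE : v = (z * S i)%g by rewrite zE -mulgA gen_mulgg mulg1.
have lenv : len v = (len z).+1.
  by apply/eqP; rewrite eqn_leq {1}vzE lenMgen /= zE.
have -> : rho v *m e i + rho v *m e j = rho z *m e j.
  rewrite -mulmxDr vzE rhoM mulmxDr rho_simple geo cox_form_simple_m3 1?cox_m_sym //.
  congr (_ *m _); rewrite addrCA -[RHS]addr0; congr (_ + _).
  by rewrite -{1}[e i]scale1r -scaleNr -scaleNr -scalerDl (_ : _ + _ = 0) ?scale0r //; lra.
apply: IH; first by rewrite -ltnS -lenv ltnW.
rewrite leqNgt; apply: contraTN ui => yj; rewrite -ltnNge.
have -> : (u * S i = z * S j * (S i * S j))%g.
  have := expg_order (S i * S j)%g; rewrite -/(cox_m S i j) m3' 2!expgS expg1 => C.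
  rewrite uE vzE -!mulgA; congr mulg.
  have V : ((S i * (S j * S i))^-1 = S i * (S j * S i))%g.
    by rewrite !invMg !gen_invg mulgA.
  by rewrite -V; apply/eqP; rewrite eq_invg_mul -!mulgA -C !mulgA.
apply: leq_ltn_trans (lenM_le _ _ _) _.
have := len_word_le S [:: i; j].
rewrite !word_eval_cons word_eval_nil mulg1 lenu lenv /=; lia.
Qed.

Lemma nonneg_or_opp a : is_root rho a -> nonneg a \/ nonneg (- a).
Proof.
move=> [u [i ->]].
have [ui|/ltnW ui] := leqP (len u) (len (u * S i)%g); first by left; apply: nonneg_of_len.
right; rewrite -mulmxN -rho_simple -rhoM; apply: nonneg_of_len.
by rewrite -mulgA gen_mulgg mulg1.
Qed.

Lemma root_not_both a : is_root rho a -> nonneg a -> ~ nonneg (- a).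
Proof. by move=> ra a0 /(nonneg0 a0) /eqP; rewrite (negPf (is_root_neq0 ra)). Qed.

(** If u acts trivially then it keeps all simple roots positive, hence has no
    descent. *)
Lemma rho_faithful u : (forall x, rho u *m x = x) -> u = 1%g.
Proof.
move=> u1; apply/eqP/negPn/negP => /(descent_ex S)[i ui].
have : nonneg (rho (u * S i)%g *m e i).
  by apply: nonneg_of_len; rewrite -mulgA gen_mulgg mulg1 ltnW.
rewrite rhoM u1 rho_simple.
exact: (root_not_both (is_root_simple i) (nonneg_simple i)).
Qed.

End Geometry.

(** * Reflections and the inner products of roots *)

Section Reflections.
Variables (gT : finGroupType) (n : nat) (S : coxeter_system gT n).
Variables (R : realType) (rho : mx_representation R [set: gT] n).
Hypothesis geo : geometric_rep S rho.
Hypothesis m3 : forall i j : 'I_n, (cox_m S i j <= 3)%N.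
Local Notation len := (cox_len S).
Local Notation eval := (word_eval S).
Local Notation B := (cox_form S).
Local Notation e := (simple_root R).
Local Notation T := (root_refl S rho).
Implicit Types (u v w t : gT) (i j : 'I_n) (l : seq 'I_n) (x y a b c d : 'cV[R]_n).

Lemma rho_inj u v : (forall x, rho u *m x = rho v *m x) -> u = v.
Proof.
move=> uv; apply/eqP; rewrite eq_mulgV1; apply/eqP.
by apply: (rho_faithful geo m3) => x; rewrite rhoM uv rhoKV.
Qed.

Lemma rho_conj u i x :
  rho (u * S i * u^-1)%g *m x =
  x - (2 * B x (rho u *m e i)) *: (rho u *m e i).
Proof.
rewrite -mulgA !rhoM geo mulmxBr -scalemxAr rhoKV; congr (_ - (2 * _) *: _).
by rewrite -(cox_form_rho geo u) rhoKV.
Qed.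

Lemma root_reflE a x : is_root rho a -> rho (T a) *m x = x - (2 * B x a) *: a.
Proof.
move=> [u [i aE]]; rewrite /root_refl; case: pickP => [[u' j] /= /eqP a'E|/(_ (u, i))].
  by rewrite rho_conj -a'E.
by rewrite /= aE eqxx.
Qed.

Lemma root_refl_uniq a u : is_root rho a ->
  (forall x, rho u *m x = x - (2 * B x a) *: a) -> T a = u.
Proof. by move=> ra uE; apply: rho_inj => x; rewrite uE root_reflE. Qed.

Lemma root_refl_simple i : T (e i) = S i.
Proof. by apply: root_refl_uniq => [|x]; rewrite ?geo //; apply: is_root_simple. Qed.

Lemma root_reflN a : is_root rho a -> T (- a) = T a.
Proof.
move=> ra; apply: root_refl_uniq => [|x]; first exact: is_rootN.
by rewrite root_reflE // cox_formNr mulrN scalerN scaleNr opprK.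
Qed.

Lemma root_refl_rho u a : is_root rho a -> T (rho u *m a) = (u * T a * u^-1)%g.
Proof.
move=> ra; apply: root_refl_uniq => [|x]; first exact: is_root_rho.
rewrite -mulgA !rhoM root_reflE // mulmxBr -scalemxAr rhoKV; congr (_ - (2 * _) *: _).
by rewrite -(cox_form_rho geo u) rhoKV.
Qed.

Lemma root_refl_mulgg a : is_root rho a -> (T a * T a = 1)%g.
Proof.
move=> [u [i ->]]; rewrite root_refl_rho ?root_refl_simple; last exact: is_root_simple.
by rewrite !mulgA mulgKV -(mulgA u) gen_mulgg mulg1 mulgV.
Qed.

Lemma root_refl_invg a : is_root rho a -> ((T a)^-1 = T a)%g.
Proof. by move=> ra; apply/eqP; rewrite eq_invg_mul root_refl_mulgg. Qed.

Lemma root_refl_refl a b : is_root rho a -> is_root rho b ->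
  T (rho (T a) *m b) = (T a * T b * T a)%g.
Proof. by move=> ra rb; rewrite root_refl_rho // root_refl_invg. Qed.

Lemma root_refl_inj a b : is_root rho a -> is_root rho b -> T a = T b ->
  b = a \/ b = - a.
Proof.
move=> ra rb ab; have := root_reflE a rb; rewrite -ab root_reflE // (cox_form_root geo ra).
move=> E.
have aE : a = B a b *: b.
  move: (B a b) E => k E; apply/matrixP => i z; rewrite ord1 mxE.
  have := congr1 (fun M : 'cV[R]_n => M i ord0) E; rewrite /= !mxE -!mulrA.
  move: (a i ord0) (k * b i ord0) => p q; lra.
have := cox_form_root geo ra; rewrite {1}aE cox_formZl cox_formC => /eqP.
rewrite -expr2 sqrf_eq1 => /orP[] /eqP k1; move: aE; rewrite cox_formC k1.
  by rewrite scale1r => ->; left.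
by rewrite scaleN1r => ->; right; rewrite opprK.
Qed.

(** The simple reflections preserve the root lattice, since 2 B takes integral
    values on simple roots. *)
Lemma root_int a : is_root rho a -> forall i, a i ord0 \is a Num.int.
Proof.
have c2 i j : 2 * B (e i) (e j) \is a Num.int.
  have [->|ij] := eqVneq i j; first by rewrite cox_form_simple1 mulr1 rpred_nat.
  have [m|m] := cox_m_2_or_3 m3 ij; first by rewrite cox_form_simple_m2 // mulr0 rpred0.
  by rewrite cox_form_simple_m3 // (_ : 2 * _ = - 1) ?rpredN ?rpred1 //; lra.
have B2 x j : (forall i, x i ord0 \is a Num.int) -> 2 * B x (e j) \is a Num.int.
  move=> xi; have -> : x = \sum_i x i ord0 *: e i.
    apply/matrixP => k z; rewrite ord1 summxE (bigD1 k) //= big1 ?addr0 => [|k' kk'].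
      by rewrite !mxE !eqxx mulr1.
    by rewrite !mxE eq_sym (negPf kk') mulr0.
  rewrite (big_morph (fun x => B x (e j)) (id1 := 0) (op1 := +%R)); first last.
  - by rewrite -(scale0r 0) cox_formZl mul0r.
  - by move=> y z; rewrite cox_formDl.
  rewrite mulr_sumr rpred_sum // => i _; rewrite cox_formZl mulrCA rpredM //.
move=> [u [i ->]]; have [l <- _] := reduced_word S u; elim: l => [|j l IH] k.
  by rewrite word_eval_nil rho1 mxE rpred_nat.
rewrite word_eval_cons rhoM; move: (_ *m e i) IH => x IH; rewrite geo !mxE; apply: rpredB => //.
by apply: rpredM; [apply: B2 | rewrite rpred_nat].
Qed.

(** After moving b to a simple root e_j, the value 2 B(a, e_j) is the difference of
    the j-th coordinates of a and s_j a. *)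
Lemma cox_form_root_int a b : is_root rho a -> is_root rho b -> 2 * B a b \is a Num.int.
Proof.
move=> ra [u [j ->]]; rewrite -(cox_form_rho geo u^-1%g) rhoK.
have := is_root_rho u^-1%g ra; move: (_ *m a) => {ra}a ra.
have := root_int (is_root_rho (S j) ra) j; rewrite geo !mxE !eqxx mulr1 => ji.
have := rpredB (root_int ra j) ji.
by rewrite opprB addrC subrK.
Qed.

(** The average over the group of the standard scalar product: a positive definite
    invariant form, which only finiteness provides. *)
Definition dot x y : R := \sum_u \sum_i (rho u *m x) i ord0 * (rho u *m y) i ord0.

Lemma dotC x y : dot x y = dot y x.
Proof. by apply: eq_bigr => u _; apply: eq_bigr => i _; rewrite mulrC. Qed.

Lemma dotD x y z : dot (x + y) z = dot x z + dot y z.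
Proof.
rewrite /dot -big_split; apply: eq_bigr => u _; rewrite -big_split; apply: eq_bigr => i _.
by rewrite mulmxDr mxE mulrDl.
Qed.

Lemma dotZ k x y : dot (k *: x) y = k * dot x y.
Proof.
rewrite /dot mulr_sumr; apply: eq_bigr => u _; rewrite mulr_sumr; apply: eq_bigr => i _.
by rewrite -scalemxAr mxE mulrA.
Qed.

Lemma dotB x y z : dot (x - y) z = dot x z - dot y z.
Proof. by rewrite dotD -scaleN1r dotZ mulN1r. Qed.

Lemma dot_rho v x y : dot (rho v *m x) (rho v *m y) = dot x y.
Proof.
rewrite [RHS](reindex_inj (mulIg v)); apply: eq_bigr => u _; apply: eq_bigr => i _.
by rewrite !rhoM.
Qed.

Lemma dot_ge0 x : 0 <= dot x x.
Proof. by apply: sumr_ge0 => u _; apply: sumr_ge0 => i _; rewrite -expr2 sqr_ge0. Qed.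

Lemma dot_eq0 x : dot x x = 0 -> x = 0.
Proof.
move=> /eqP; rewrite psumr_eq0 => [|u _]; last first.
  by apply: sumr_ge0 => i _; rewrite -expr2 sqr_ge0.
move=> /allP /(_ 1%g); rewrite mem_index_enum psumr_eq0 => [/(_ isT)/allP x0|i _]; last first.
  by rewrite -expr2 sqr_ge0.
apply/matrixP => i j; rewrite ord1 mxE; apply/eqP.
by have := x0 i; rewrite mem_index_enum rho1 mulf_eq0 orbb; apply.
Qed.

(** The root reflection t_a is orthogonal for the averaged form as well, so both
    forms express it by the same formula. *)
Lemma dot_root x a : is_root rho a -> dot x a = B x a * dot a a.
Proof.
move=> ra; have Ta : rho (T a) *m a = - a.
  by rewrite root_reflE // (cox_form_root geo ra) mulr1 scaler_nat mulr2n opprD addNKr.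
have := dot_rho (T a) x a; rewrite Ta root_reflE // dotC -scaleN1r dotZ dotC dotB dotZ.
lra.
Qed.

(** If B(a, b) is nonzero, dot_root makes a and b equally long for the averaged
    form, for which B(a, b) is then the cosine of their angle: Cauchy-Schwarz bounds
    it strictly by 1, and integrality leaves three values. *)
Lemma root_pair_cases a b : is_root rho a -> is_root rho b -> a <> b -> a <> - b ->
  [\/ 2 * B a b = 0, 2 * B a b = 1 | 2 * B a b = - 1].
Proof.
move=> ra rb ab aNb; set k := B a b.
have lt1 : k ^+ 2 < 1.
  have [->|k0] := eqVneq k 0; first by rewrite expr0n ltr01.
  have Dpos : 0 < dot b b.
    rewrite lt_neqAle dot_ge0 andbT eq_sym; apply/eqP => /dot_eq0/eqP.
    by rewrite (negPf (is_root_neq0 rb)).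
  have DE : dot a a = dot b b.
    by apply: (mulfI k0); rewrite -[RHS](dot_root a rb) [RHS]dotC (dot_root b ra) (cox_formC S b).
  have E : dot (a - k *: b) (a - k *: b) = (1 - k ^+ 2) * dot b b.
    rewrite dotB dotZ dotC (dotC b) !dotB !dotZ (dotC b a) (dot_root a rb) DE -/k; ring.
  have : 0 <= 1 - k ^+ 2 by rewrite -(pmulr_lge0 _ Dpos) -E dot_ge0.
  rewrite subr_ge0 le_eqVlt => /orP[/eqP k1|//]; exfalso.
  move: E; rewrite k1 subrr mul0r => /dot_eq0/eqP; rewrite subr_eq0 => /eqP aE.
  move/eqP: k1; rewrite sqrf_eq1 => /orP[] /eqP k1; rewrite k1 in aE.
    by apply: ab; rewrite aE scale1r.
  by apply: aNb; rewrite aE scaleN1r.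
have /intrP[z zE] := cox_form_root_int ra rb; rewrite -/k in zE *.
have : (z%:~R : R) ^+ 2 < (4 : int)%:~R by rewrite -zE; move: lt1; rewrite !expr2; lra.
rewrite -rmorphXn /= ltr_int => z4; rewrite zE.
have [|[]] : z = 0 \/ z = 1 \/ z = -1 by move: z4; rewrite expr2; nia.
- by move->; apply: Or31.
- by move->; apply: Or32.
- by move->; apply: Or33.
Qed.

End Reflections.

(** * Inversions of a reduced word *)

(** The coordinates of a third unit vector in the plane of two roots: here k, P and Q
    are the products B(a, b), B(c, a) and B(c, b), and c = p a + q b. *)
Lemma rank2_coords (F : realFieldType) (k P Q p q : F) :
  [\/ 2 * k = 0, 2 * k = 1 | 2 * k = - 1] ->
  [\/ 2 * P = 0, 2 * P = 1 | 2 * P = - 1] ->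
  [\/ 2 * Q = 0, 2 * Q = 1 | 2 * Q = - 1] ->
  P = p + q * k -> Q = p * k + q -> p * P + q * Q = 1 ->
  p = 1 /\ q = - (2 * k) \/ p = - 1 /\ q = 2 * k.
Proof.
have half (r z : F) : 2 * r = z -> r = z / 2 by move=> <-; rewrite mulrC mulKf ?pnatr_eq0.
move=> kE PE QE.
case: kE => /half->; case: PE => /half->; case: QE => /half-> h1 h2 h3; try by exfalso; lra.
all: try by left; split; lra.
all: by right; split; lra.
Qed.

Section Words.
Variables (gT : finGroupType) (n : nat) (S : coxeter_system gT n).
Variables (R : realType) (rho : mx_representation R [set: gT] n).
Hypothesis geo : geometric_rep S rho.
Hypothesis m3 : forall i j : 'I_n, (cox_m S i j <= 3)%N.
Local Notation len := (cox_len S).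
Local Notation eval := (word_eval S).
Local Notation reduced := (reduced S).
Local Notation B := (cox_form S).
Local Notation e := (simple_root R).
Local Notation T := (root_refl S rho).
Implicit Types (u v w t : gT) (i j : 'I_n) (l : seq 'I_n) (x y a b c d : 'cV[R]_n).

(** Evaluating both products at x = c - B(c, d) d, which is orthogonal to d, shows
    that a nonzero multiple of c lies in the span of a and b; the roots of that plane
    are known from rank2_coords. *)
Lemma refl_product_plane a b c d :
  is_root rho a -> is_root rho b -> is_root rho c -> is_root rho d ->
  a <> b -> a <> - b -> (T c * T d = T a * T b)%g ->
  [\/ c = a \/ c = - a, c = b \/ c = - b |
      c = rho (T b) *m a \/ c = - (rho (T b) *m a)].
Proof.
move=> ra rb rc rd ab aNb E.
have cd1 : T c <> T d.
  move=> cd; have := E; rewrite cd root_refl_mulgg // => /esym/eqP.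
  rewrite -eq_invg_mul root_refl_invg // => /eqP /(root_refl_inj geo ra rb) [] ba.
    exact: ab.
  by apply: aNb; rewrite ba opprK.
have cd : c <> d by move=> cd; apply: cd1; rewrite cd.
have cNd : c <> - d by move=> cNd; apply: cd1; rewrite cNd root_reflN.
have [p [q cE]] : exists p q, c = p *: a + q *: b.
  pose x := c - B c d *: d; pose z := 2 * B x c.
  have xd : B x d = 0 by rewrite cox_formBl cox_formZl (cox_form_root geo rd) mulr1 subrr.
  have zE : z = 2 * (1 - B c d ^+ 2).
    by rewrite /z cox_formBl cox_formZl (cox_form_root geo rc) (cox_formC S d) expr2.
  have z0 : z != 0.
    rewrite zE expr2; apply/eqP.
    by case: (root_pair_cases geo m3 rc rd cd cNd) => h; nra.
  have := congr1 (fun g => rho g *m x) E; rewrite /= !rhoM (root_reflE geo _ rd) xd.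
  rewrite mulr0 scale0r subr0 !root_reflE // -/z.
  set s := 2 * B x b; set t := 2 * B _ a.
  rewrite -[_ - s *: b - _]addrA -opprD => /GRing.addrI h; have zc := GRing.oppr_inj h.
  exists (z^-1 * t), (z^-1 * s).
  by rewrite -(scalerA _ t) -(scalerA _ s) -scalerDr (addrC (t *: a)) -zc scalerA mulVf // scale1r.
have [ca|ca] := EM (c = a \/ c = - a); first exact: Or31.
have [cb|cb] := EM (c = b \/ c = - b); first exact: Or32.
apply: Or33; rewrite root_reflE //.
have caB := root_pair_cases geo m3 rc ra (fun h => ca (or_introl h)) (fun h => ca (or_intror h)).
have cbB := root_pair_cases geo m3 rc rb (fun h => cb (or_introl h)) (fun h => cb (or_intror h)).
have abB := root_pair_cases geo m3 ra rb ab aNb.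
have ccE := cox_form_root geo rc; rewrite {1}cE in ccE.
have caE : B c a = p + q * B a b.
  by rewrite cE cox_formDl !cox_formZl (cox_form_root geo ra) (cox_formC S b) mulr1.
have cbE : B c b = p * B a b + q.
  by rewrite cE cox_formDl !cox_formZl (cox_form_root geo rb) mulr1.
rewrite cox_formDl !cox_formZl !(cox_formC S _ c) in ccE.
move: (B a b) (B c a) (B c b) caB cbB abB caE cbE ccE => k P Q caB cbB abB caE cbE ccE.
have [[pE qE]|[pE qE]] := rank2_coords abB caB cbB caE cbE ccE.
- by left; rewrite cE pE qE scale1r scaleNr.
- by right; rewrite cE pE qE scaleN1r opprB addrC.
Qed.

Lemma root_supp x i : is_root rho x -> nonneg x ->
  (forall j, j != i -> x j ord0 = 0) -> x = e i.
Proof.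
move=> rx x0 xi; have xE : x = x i ord0 *: e i.
  apply/matrixP => j z; rewrite ord1 !mxE eqxx andbT.
  have [->|ji] := eqVneq j i; first by rewrite mulr1.
  by rewrite (xi j ji) mulr0.
have := x0 i; move: (x i ord0) xE => k xE k0.
have := cox_form_root geo rx; rewrite xE cox_formZl cox_formZr cox_form_simple1 mulr1.
move/eqP; rewrite -expr2 sqrf_eq1 => /orP[] /eqP kE; first by rewrite kE scale1r.
by move: k0; rewrite kE ler0N1.
Qed.

(** A simple reflection s_i changes only the i-th coordinate. *)
Lemma root_simple_neg x i : is_root rho x -> nonneg x ->
  nonneg (- (rho (S i) *m x)) -> x = e i.
Proof.
move=> rx x0; rewrite geo => sx0; apply: root_supp => // j ji.
apply/eqP; rewrite eq_le x0 andbT; have := sx0 j.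
by rewrite !mxE (negPf ji) mulr0 subr0 oppr_ge0.
Qed.

Lemma simple_root_indecomposable x y i : is_root rho x -> is_root rho y ->
  nonneg x -> nonneg y -> e i <> x + y.
Proof.
move=> rx ry x0 y0 E.
have H j : j != i -> x j ord0 = 0 /\ y j ord0 = 0.
  move=> ji; have := congr1 (fun M : 'cV[R]_n => M j ord0) E; rewrite /= !mxE (negPf ji) => h.
  have {h} : 0 = x j ord0 + y j ord0 := h.
  by have := x0 j; have := y0 j; move=> *; split; lra.
have xE : x = e i by apply: root_supp => // j /H[].
have yE : y = e i by apply: root_supp => // j /H[].
move: E; rewrite xE yE.
by move/(congr1 (fun M : 'cV[R]_n => M i ord0)); rewrite /= !mxE !eqxx /= => h; have : (1 : R) = 1 + 1 := h; lra.
Qed.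

Lemma reduced_rev l : reduced (rev l) = reduced l.
Proof. by rewrite /reduced word_eval_rev lenV size_rev. Qed.

Lemma nonneg_reduced_rcons l i : reduced (rcons l i) -> nonneg (rho (eval l) *m e i).
Proof.
move=> r; apply: (nonneg_of_len geo m3); move: (r); rewrite -cats1 => /reduced_cat[/eqP-> _].
move: r => /eqP; rewrite -cats1 word_eval_cat word_eval_cons word_eval_nil mulg1 => ->.
by rewrite size_cat leq_addr.
Qed.

Lemma nonneg_reduced_cons l i : reduced (i :: l) -> nonneg (rho (eval l)^-1%g *m e i).
Proof.
by move=> r; rewrite -word_eval_rev; apply: nonneg_reduced_rcons; rewrite -rev_cons reduced_rev.
Qed.

(* i0 only serves as a default value for nth. *)
Variable i0 : 'I_n.

(** The m-th inversion of the word l: a root made negative by l when l is reduced. *)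
Definition inv_root l m : 'cV[R]_n :=
  rho (eval (drop m.+1 l))^-1%g *m e (nth i0 l m).

Lemma inv_root_is_root l m : is_root rho (inv_root l m).
Proof. exact/is_root_rho/is_root_simple. Qed.

Lemma drop_split l (m j : nat) : (m <= j)%N -> (j < size l)%N ->
  drop m l = rcons (take (j - m) (drop m l)) (nth i0 l j) ++ drop j.+1 l.
Proof.
move=> mj jl; rewrite cat_rcons -{1}(cat_take_drop (j - m) (drop m l)).
by rewrite drop_drop subnK // -drop_nth.
Qed.

Lemma inv_root_refl l m : (m < size l)%N ->
  (eval l * T (inv_root l m))%g = eval (take m l ++ drop m.+1 l).
Proof.
move=> ml; rewrite root_refl_rho ?root_refl_simple //; last exact: is_root_simple.
have := drop_split (leq0n m) ml; rewrite drop0 subn0 => lE.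
rewrite {1}lE cat_rcons !word_eval_cat word_eval_cons invgK -!mulgA.
by rewrite mulKVg (mulgA (S _)) gen_mulgg mul1g.
Qed.

(** Apply the letters of l to a one by one from the right: at the letter where the
    sign changes, the current root must be the corresponding simple root. *)
Lemma inversion_is_inv_root l a : is_root rho a -> nonneg a ->
  nonneg (- (rho (eval l) *m a)) -> exists2 m, (m < size l)%N & a = inv_root l m.
Proof.
move=> ra a0; elim: l => [|i l IH]; rewrite ?word_eval_nil ?rho1.
  by move/(root_not_both ra a0).
rewrite word_eval_cons rhoM => la.
have [lp|/IH[m ml aE]] := nonneg_or_opp geo m3 (is_root_rho (eval l) ra); last first.
  by exists m.+1.
exists 0%N => //; rewrite /inv_root /= drop0.
by rewrite -(root_simple_neg _ lp la) ?rhoK //; apply: is_root_rho.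
Qed.

Lemma pos_reflection t : is_reflection S t ->
  exists a, [/\ is_root rho a, nonneg a & t = T a].
Proof.
case/existsP => -[u i] /= /eqP tE.
have ra := is_root_rho u (is_root_simple rho i).
have TE : t = T (rho u *m e i).
  by rewrite root_refl_rho ?root_refl_simple //; apply: is_root_simple.
have [p|p] := nonneg_or_opp geo m3 ra; first by exists (rho u *m e i).
by exists (- (rho u *m e i)); split=> //; [apply: is_rootN | rewrite root_reflN].
Qed.

(** Let t be the reflection in the positive root a. If l made a negative, a would be
    an inversion and the exchange is inv_root_refl. Otherwise eval l * t makes a
    negative, and the same argument for that element yields the opposite
    inequality between the lengths. *)
Lemma strong_exchange l t : is_reflection S t -> (len (eval l * t)%g < len (eval l))%N ->
  exists2 m, (m < size l)%N & (eval l * t)%g = eval (take m l ++ drop m.+1 l).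
Proof.
move=> /pos_reflection[a [ra a0 ->]] lt.
have [p|/(inversion_is_inv_root ra a0)[m ml ->]] :=
    nonneg_or_opp geo m3 (is_root_rho (eval l) ra); last first.
  by exists m => //; apply: inv_root_refl.
have [l' l'E sl'] := reduced_word S (eval l * T a)%g.
have [|m ml aE] := inversion_is_inv_root (l := l') ra a0.
  rewrite l'E rhoM [rho (T a) *m a]root_reflE // (cox_form_root geo ra) mulr1.
  by rewrite scaler_nat mulr2n opprD addNKr mulmxN opprK.
have := len_word_le S (take m l' ++ drop m.+1 l').
rewrite -inv_root_refl // -aE l'E -mulgA root_refl_mulgg // mulg1 size_cat size_take ml size_drop.
by move: lt ml; rewrite -sl'; lia.
Qed.

Section Reduced.
Variable l : seq 'I_n.
Hypothesis redl : reduced l.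
Local Notation U m := (eval (drop m.+1 l)).
Local Notation beta := (inv_root l).

Lemma reduced_drop m : reduced (drop m l).
Proof. by have := redl; rewrite -{1}(cat_take_drop m l) => /reduced_cat[]. Qed.

Lemma tail_inv_root m : rho (U m) *m beta m = e (nth i0 l m).
Proof. exact: rhoKV. Qed.

(** The sign of a given inversion after applying the tail of the word behind position
    m tells on which side of m the inversion stands; with the next lemma, this is what
    makes the enumeration of the inversions convex. *)
Lemma tail_inv_root_ge0 (m j : nat) : (j <= m < size l)%N -> nonneg (rho (U m) *m beta j).
Proof.
case/andP; rewrite leq_eqVlt => /predU1P[->|jm] ml.
  by rewrite tail_inv_root; apply: nonneg_simple.
have jl := ltn_trans jm ml.
have := reduced_drop j; rewrite (drop_nth i0) // (drop_split jm ml) -cat_cons => /reduced_cat[r _].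
rewrite /inv_root (drop_split jm ml) word_eval_cat invMg rhoM rhoKV.
exact: nonneg_reduced_cons.
Qed.

Lemma tail_inv_root_le0 (m j : nat) : (m < j < size l)%N -> nonneg (- (rho (U m) *m beta j)).
Proof.
case/andP => mj jl.
have := reduced_drop m.+1; rewrite (drop_split mj jl) => /reduced_cat[r _].
rewrite -cats1 -catA word_eval_cat -[_ ++ drop _ _]/(_ :: _) word_eval_cons !rhoM.
rewrite tail_inv_root rho_simple // mulmxN opprK.
exact: nonneg_reduced_rcons.
Qed.

Lemma inv_root_ge0 (j : nat) : (j < size l)%N -> nonneg (beta j).
Proof.
move=> jl; apply: nonneg_reduced_cons.
by rewrite -drop_nth //; apply: reduced_drop.
Qed.

Lemma inv_root_inj (m j : nat) : (m < size l)%N -> (j < size l)%N -> beta m = beta j -> m = j.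
Proof.
wlog mj : m j / (m < j)%N => [H ml jl E|ml jl E].
  have [mj|jm|//] := ltngtP m j; first exact: H.
  by apply/esym/H.
have := tail_inv_root_le0 (m := m) (j := j); rewrite mj jl => /(_ isT).
rewrite -E tail_inv_root => /(root_not_both (is_root_simple rho _) (nonneg_simple _ _)) [].
Qed.

(** Apply the tail behind m: the root at m becomes simple, so the two summands can be
    neither both positive nor both negative. *)
Lemma inv_root_between m p q :
  (m < size l)%N -> (p < size l)%N -> (q < size l)%N ->
  beta m = beta p + beta q -> (p < m < q)%N \/ (q < m < p)%N.
Proof.
wlog pq : p q / (p <= q)%N => [H ml pl ql E|ml pl ql E].
  have [pq|/ltnW qp] := leqP p q; first exact: H.
  by have [] := H q p qp ml ql pl; rewrite 1?addrC // => ?; [right|left].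
left; have UE : e (nth i0 l m) = rho (U m) *m beta p + rho (U m) *m beta q.
  by rewrite -mulmxDr -E tail_inv_root.
have rU (j : nat) : is_root rho (rho (U m) *m beta j) by apply/is_root_rho/inv_root_is_root.
apply/andP; split; rewrite ltnNge; apply/negP => mp.
  have [pm|pm] := eqVneq p m.
    have := is_root_neq0 (inv_root_is_root l q).
    by move/eqP: E; rewrite pm -subr_eq0 opprD addNKr oppr_eq0 => ->.
  have mp' : (m < p)%N by rewrite ltn_neqAle eq_sym pm.
  apply: (root_not_both (is_root_simple rho (nth i0 l m)) (nonneg_simple _ _)).
  rewrite UE opprD; apply: nonnegD; apply: tail_inv_root_le0; rewrite ?mp' ?pl //.
  by rewrite (leq_trans mp' pq).
have qm : (q <= m < size l)%N by rewrite mp.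
have pm : (p <= m < size l)%N by rewrite (leq_trans pq mp).
exact: simple_root_indecomposable (rU p) (rU q) (tail_inv_root_ge0 pm) (tail_inv_root_ge0 qm) UE.
Qed.

(** Apply the tail behind q: the root at q becomes simple and the one at p positive,
    so d becomes negative and is an inversion of the tail. *)
Lemma inv_root_split p q d : (p < q < size l)%N -> is_root rho d -> nonneg d ->
  beta q = beta p + d -> exists2 r, (r < size l)%N & d = beta r.
Proof.
case/andP => pq ql rd d0 E.
have UE : e (nth i0 l q) = rho (U q) *m beta p + rho (U q) *m d.
  by rewrite -mulmxDr -E tail_inv_root.
have [dp|/(inversion_is_inv_root rd d0)[r rl dE]] :=
    nonneg_or_opp geo m3 (is_root_rho (U q) rd).
  have pq' : (p <= q < size l)%N by rewrite (ltnW pq).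
  have rp := is_root_rho (U q) (inv_root_is_root l p).
  by case: (simple_root_indecomposable rp (is_root_rho _ rd) (tail_inv_root_ge0 pq') dp UE).
exists (q.+1 + r)%N; first by move: rl; rewrite size_drop; lia.
by rewrite dE /inv_root nth_drop drop_drop addSn (addnC r).
Qed.

End Reduced.
End Words.

(** * Pairs of inversions with a given product of reflections *)

Section Pairs.
Variables (gT : finGroupType) (n : nat) (S : coxeter_system gT n).
Variables (R : realType) (rho : mx_representation R [set: gT] n).
Hypothesis geo : geometric_rep S rho.
Hypothesis m3 : forall i j : 'I_n, (cox_m S i j <= 3)%N.
Local Notation len := (cox_len S).
Local Notation eval := (word_eval S).
Local Notation B := (cox_form S).
Local Notation e := (simple_root R).
Local Notation T := (root_refl S rho).
Implicit Types (u v w t : gT) (x y a b c d : 'cV[R]_n).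

Lemma nonneg_root_neqN a b : is_root rho a -> nonneg a -> nonneg b -> a <> - b.
Proof. by move=> ra a0 b0 E; apply: (root_not_both ra a0); rewrite E opprK. Qed.

Lemma root_refl_nonneg_inj a b : is_root rho a -> is_root rho b -> nonneg a -> nonneg b ->
  T a = T b -> a = b.
Proof.
move=> ra rb a0 b0 /(root_refl_inj geo ra rb)[//|ba].
by case: (nonneg_root_neqN rb b0 a0).
Qed.

Lemma root_refl_braid a b : is_root rho a -> is_root rho b ->
  2 * B a b = 1 \/ 2 * B a b = - 1 -> (T a * T b * T a = T b * T a * T b)%g.
Proof.
move=> ra rb ab; have rf := is_root_rho (T b) ra; rewrite root_reflE // in rf.
rewrite -!root_refl_refl // !root_reflE // (cox_formC S b).
case: ab rf => ->; rewrite ?scale1r ?scaleN1r ?opprK => rf; last by rewrite addrC.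
by rewrite -[b - a]opprB root_reflN.
Qed.

(** When c is the third root of the plane, a and b span a system of type A_2 and the
    braid relation turns T d into T a. *)
Lemma refl_product_pairs a b c d :
  is_root rho a -> is_root rho b -> is_root rho c -> is_root rho d ->
  nonneg a -> nonneg b -> nonneg c -> nonneg d -> a <> b ->
  (T c * T d = T a * T b)%g ->
  let f := rho (T b) *m a in
  [\/ c = a /\ d = b, c = b /\ (d = f \/ d = - f) | (c = f \/ c = - f) /\ d = a].
Proof.
move=> ra rb rc rd a0 b0 c0 d0 ab E f.
have rf : is_root rho f by apply: is_root_rho.
have aNb := nonneg_root_neqN ra a0 b0.
have Tf : T f = (T b * T a * T b)%g by rewrite root_refl_refl.
have Ta : c = a -> d = b.
  by move=> ca; move: E; rewrite ca => /mulgI; apply: root_refl_nonneg_inj.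
case: (refl_product_plane geo m3 ra rb rc rd ab aNb E) => [[ca|ca]|[cb|cb]|cf].
- by apply: Or31; split=> //; apply: Ta.
- by case: (nonneg_root_neqN rc c0 a0).
- apply: Or32; split=> //.
  have : T f = T d by rewrite Tf -mulgA -E cb mulgA root_refl_mulgg // mul1g.
  by apply: (root_refl_inj geo rf rd).
- by case: (nonneg_root_neqN rc c0 b0).
have Tc : T c = T f by case: cf => ->; rewrite ?root_reflN.
case: (root_pair_cases geo m3 ra rb ab aNb) => k.
- have fa : f = a by rewrite /f root_reflE // k scale0r subr0.
  have ca : c = a by apply: root_refl_nonneg_inj; rewrite // Tc fa.
  by apply: Or31; split=> //; apply: Ta.
all: apply: Or33; split=> //; apply: root_refl_nonneg_inj => //.
all: have br := root_refl_braid ra rb.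
all: apply: (mulgI (T c)); rewrite E Tc Tf -br; [|by [left|right]].
all: by rewrite -!mulgA root_refl_mulgg // mulg1.
Qed.

Lemma root_triple a b c : is_root rho a -> is_root rho b -> is_root rho c -> b = a + c ->
  [/\ rho (T a) *m c = b, rho (T c) *m b = a & rho (T b) *m a = - c].
Proof.
move=> ra rb rc bE.
have aa := cox_form_root geo ra; have cc := cox_form_root geo rc.
have ac : 2 * B a c = - 1.
  have := cox_form_root geo rb.
  by rewrite bE !(cox_formDl, cox_formDr) aa cc (cox_formC S c); lra.
have bc : 2 * B b c = 1 by rewrite bE cox_formDl cc; lra.
have ab : 2 * B a b = 1 by rewrite bE cox_formDr aa; lra.
rewrite !root_reflE // (cox_formC S c) ac bc ab !scale1r scaleN1r opprK bE.
by split; rewrite ?addrK ?opprD ?addNKr // addrC.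
Qed.

Lemma root_triple_refl a b c : is_root rho a -> is_root rho b -> is_root rho c -> b = a + c ->
  [/\ (T a * T c = T c * T b)%g, (T b * T a = T a * T c)%g & (T a * T b = T b * T c)%g].
Proof.
move=> ra rb rc /(root_triple ra rb rc)[bE aE cE].
split; first by rewrite -{1}aE root_refl_refl // -!mulgA root_refl_mulgg // mulg1.
  by rewrite -{1}bE root_refl_refl // -!mulgA root_refl_mulgg // mulg1.
by rewrite -[T c]root_reflN // -cE root_refl_refl // !mulgA root_refl_mulgg // mul1g.
Qed.

Variable i0 : 'I_n.
Variable l : seq 'I_n.
Hypothesis redl : reduced S l.
Local Notation beta := (inv_root S rho i0 l).

Lemma pair_indices p q p' q' :
  (p < q < size l)%N -> (p' < q' < size l)%N ->
  (T (beta p') * T (beta q') = T (beta p) * T (beta q))%g ->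
  let f := rho (T (beta q)) *m beta p in
  [\/ p' = p /\ q' = q, p' = q /\ (beta q' = f \/ beta q' = - f) |
      (beta p' = f \/ beta p' = - f) /\ q' = p].
Proof.
case/andP => pq ql /andP[pq' ql'] E f.
have pl := ltn_trans pq ql; have pl' := ltn_trans pq' ql'.
have rb m : is_root rho (beta m) by apply: inv_root_is_root.
have b0 m : (m < size l)%N -> nonneg (beta m) by apply: inv_root_ge0.
have inj := inv_root_inj geo m3 (i0 := i0) redl.
have ab : beta p <> beta q by move/inj => h; move: pq; rewrite (h pl ql) ltnn.
have := refl_product_pairs (rb p) (rb q) (rb p') (rb q')
  (b0 _ pl) (b0 _ ql) (b0 _ pl') (b0 _ ql') ab E.
case=> [[/inj h1 /inj h2]|[/inj h1 h2]|[h1 /inj h2]].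
- by apply: Or31; rewrite h1 // h2.
- by apply: Or32; rewrite h1.
- by apply: Or33; rewrite h2.
Qed.

(** The third candidate (r, p) of pair_indices is in the wrong order. *)
Lemma triple_pairs p q r p' q' :
  (p < q < r)%N -> (r < size l)%N -> beta q = beta p + beta r ->
  (p' < q' < size l)%N -> (T (beta p') * T (beta q') = T (beta p) * T (beta q))%g ->
  p' = p /\ q' = q \/ p' = q /\ q' = r.
Proof.
case/andP => pq qr rl E pq' TE.
have ql := ltn_trans qr rl.
have [p'l q'l] : (p' < size l)%N /\ (q' < size l)%N.
  by case/andP: pq' => h1 h2; split=> //; apply: ltn_trans h1 h2.
have rb m : is_root rho (beta m) by apply: inv_root_is_root.
have b0 m : (m < size l)%N -> nonneg (beta m) by apply: inv_root_ge0.
have inj := inv_root_inj geo m3 (i0 := i0) redl.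
have [_ _ fE] := root_triple (rb p) (rb q) (rb r) E.
have pql : (p < q < size l)%N by rewrite pq.
have := pair_indices pql pq' TE; rewrite /= fE opprK => -[|[-> [h|/inj h]]|[[h|/inj h] q'E]].
- by left.
- by case: (nonneg_root_neqN (rb q') (b0 _ q'l) (b0 _ rl)).
- by right; rewrite h.
- by case: (nonneg_root_neqN (rb p') (b0 _ p'l) (b0 _ rl)).
- by move: pq'; rewrite h // q'E; lia.
Qed.

(** By pair_indices, any further pair involves the root f = t_q beta_p, up to sign.
    If B(beta_p, beta_q) = 0 then f = beta_p. If f = beta_p + beta_q, then f would have
    to stand between p and q. If f = beta_p - beta_q, one of beta_p, beta_q is the sum
    of the other and f or -f, and a further pair occurs exactly when f or -f is an
    inversion. *)
Lemma pairs_dichotomy p0 q0 : (p0 < q0 < size l)%N ->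
  let Z p q := (p < q < size l)%N /\
    (T (beta p) * T (beta q) = T (beta p0) * T (beta q0))%g in
  (exists p q, [/\ Z p q, nonneg (rho (T (beta q)) *m beta p) &
     forall p' q', Z p' q' -> p' = p /\ q' = q]) \/
  (exists p q r, [/\ Z p q, Z q r, beta q = beta p + beta r, (p < q < r)%N &
     forall p' q', Z p' q' -> p' = p /\ q' = q \/ p' = q /\ q' = r]).
Proof.
rename p0 into p; rename q0 into q; move=> pql Z.
have /andP[pq ql] := pql; have pl := ltn_trans pq ql.
have rb m : is_root rho (beta m) by apply: inv_root_is_root.
have b0 m : (m < size l)%N -> nonneg (beta m) by apply: inv_root_ge0.
have inj := inv_root_inj geo m3 (i0 := i0) redl.
have between := inv_root_between geo m3 (i0 := i0) redl.
have ab : beta p <> beta q by move/inj => h; move: pq; rewrite (h pl ql) ltnn.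
have aNb := nonneg_root_neqN (rb p) (b0 _ pl) (b0 _ ql).
pose f := rho (T (beta q)) *m beta p.
have rf : is_root rho f by apply: is_root_rho.
have fE : f = beta p - (2 * B (beta p) (beta q)) *: beta q by rewrite /f root_reflE.
have Zpq : Z p q by [].
have Zl p' q' : Z p' q' -> [/\ (p' < size l)%N, (q' < size l)%N & (p' < q')%N].
  by case=> /andP[h1 h2] _; split=> //; apply: ltn_trans h1 h2.
have single : nonneg f ->
    (forall p' q', Z p' q' -> ~ (p' = q /\ beta q' = f) /\ ~ (beta p' = f /\ q' = p)) ->
    exists p q, [/\ Z p q, nonneg (rho (T (beta q)) *m beta p) &
     forall p' q', Z p' q' -> p' = p /\ q' = q].
  move=> f0 H; exists p, q; split=> // p' q' Zp; have [H1 H2] := H _ _ Zp.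
  have [p'l q'l _] := Zl _ _ Zp; case: Zp => pq' TE.
  case: (pair_indices pql pq' TE) => [//|[h1 [h2|h2]]|[[h1|h1] h2]].
  - by case: H1.
  - by case: (nonneg_root_neqN (rb q') (b0 _ q'l) f0).
  - by case: H2.
  - by case: (nonneg_root_neqN (rb p') (b0 _ p'l) f0).
case: (root_pair_cases geo m3 (rb p) (rb q) ab aNb) => k; rewrite k in fE.
- have fp : f = beta p by rewrite fE scale0r subr0.
  left; apply: single; rewrite fp; first exact: b0.
  move=> p' q' /Zl[p'l q'l pq']; split=> -[].
    by move=> p'E /inj q'E; move: pq'; rewrite p'E q'E // ltnNge (ltnW pq).
  by move=> /inj p'E q'E; move: pq'; rewrite p'E // q'E ltnn.
- (* Whichever of f and - f is positive, it is the third positive root of the plane. *)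
  have pE : beta p = beta q + f by rewrite fE scale1r addrC subrK.
  have [f0|f0] := nonneg_or_opp geo m3 rf.
    have [[r rl fr]|nr] := EM (exists2 r, (r < size l)%N & f = beta r); last first.
      left; apply: single => // p' q' /Zl[p'l q'l pq']; split=> -[h1 h2]; apply: nr.
        by exists q'.
      by exists p'.
    rewrite fr addrC in pE; have rpq : (r < p < q)%N.
      by have [|/andP[h _]] := between _ _ _ pl rl ql pE => //; move: pq; lia.
    have [_ _ TE] := root_triple_refl (rb r) (rb p) (rb q) pE.
    right; exists r, p, q; split=> //.
      by split; [move: rpq; lia | rewrite TE].
    move=> p' q' [h1 h2]; apply: triple_pairs => //.
    by rewrite h2 TE.
  have qE : beta q = beta p + - f by rewrite pE addrK.
  have [r rl fr] := inv_root_split geo m3 redl pql (is_rootN geo rf) f0 qE.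
  rewrite fr in qE; have pqr : (p < q < r)%N.
    by have [|/andP[_ h]] := between _ _ _ ql pl rl qE => //; move: pq; lia.
  have [_ _ TE] := root_triple_refl (rb p) (rb q) (rb r) qE.
  right; exists p, q, r; split=> //.
    by split; [move: pqr; lia | rewrite TE].
  by move=> p' q' [h1 h2]; apply: triple_pairs.
(* Now f is the middle root of the plane, so it can only stand between p and q. *)
have fpq : f = beta p + beta q by rewrite fE scaleN1r opprK.
left; apply: single; first by rewrite fpq; apply: nonnegD; apply: b0.
move=> p' q' /Zl[p'l q'l pq']; split=> -[].
  move=> p'E q'E; rewrite fpq in q'E.
  by have [] := between _ _ _ q'l pl ql q'E; move: pq pq'; rewrite p'E; lia.
move=> p'E q'E; rewrite fpq in p'E.
by have [] := between _ _ _ p'l pl ql p'E; move: pq pq'; rewrite q'E; lia.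
Qed.

End Pairs.

(** * Divided differences on polynomials and on the coinvariant algebra *)

Section Operators.
Variables (gT : finGroupType) (n : nat) (S : coxeter_system gT n).
Variables (R : realType) (rho : mx_representation R [set: gT] n).
Hypothesis geo : geometric_rep S rho.
Hypothesis m3 : forall i j : 'I_n, (cox_m S i j <= 3)%N.
Local Notation eval := (word_eval S).
Local Notation B := (cox_form S).
Local Notation e := (simple_root R).
Local Notation T := (root_refl S rho).
Local Notation dd a := (@coinv_dd _ _ S _ rho a).
Local Notation act u := (@coinv_act _ _ _ rho u).
Implicit Types (u v w : gT) (a b c : 'cV[R]_n) (f g : {mpoly R[i][n]}).

Lemma linform_sum (I : Type) (r : seq I) (F : I -> 'cV[R]_n) :
  linform (\sum_(i <- r) F i) = \sum_(i <- r) linform (F i).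
Proof.
apply: (big_morph (@linform n R) (@linformD n R)).
by rewrite -(scale0r 0) linformZ rmorph0 scale0r.
Qed.

Lemma linformN a : linform (- a) = - linform a.
Proof. by rewrite -scaleN1r linformZ rmorphN rmorph1 scaleN1r. Qed.

Lemma sym_act_linform u a : sym_act rho u (linform a) = linform (rho u *m a).
Proof.
have aE : a = \sum_i a i ord0 *: e i.
  apply/matrixP => k z; rewrite ord1 summxE (bigD1 k) //= big1 ?addr0 => [|k' kk'].
    by rewrite !mxE !eqxx mulr1.
  by rewrite !mxE eq_sym (negPf kk') mulr0.
rewrite {2}aE mulmx_sumr linform_sum /sym_act raddf_sum; apply: eq_bigr => i _.
rewrite -scalemxAr linformZ /= comp_mpolyZ comp_mpolyXU.
by rewrite -tnth_nth tnth_mktuple.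
Qed.

Lemma sym_act_act u v f : sym_act rho (u * v)%g f = sym_act rho u (sym_act rho v f).
Proof.
have H w : sym_act rho w f =
    \sum_(m <- msupp f) f@_m *: \prod_(i < n) linform (rho w *m e i) ^+ m i.
  rewrite /sym_act comp_mpolyEX; apply: eq_bigr => m _; rewrite comp_mpolyX.
  by congr (_ *: _); apply: eq_bigr => i _; rewrite tnth_mktuple.
rewrite (H (u * v)%g) (H v) [RHS]raddf_sum; apply: eq_bigr => m _.
rewrite [RHS]comp_mpolyZ rmorph_prod; congr (_ *: _); apply: eq_bigr => i _.
by rewrite rmorphXn /= rhoM -sym_act_linform.
Qed.

Lemma sym_act1 f : sym_act rho 1%g f = f.
Proof.
rewrite /sym_act (_ : [tuple _ | _ < _] = [tuple 'X_i | i < n]) ?comp_mpoly_id //.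
by apply: eq_mktuple => i; rewrite rho1 linform_simple.
Qed.

Lemma sym_actK u f : sym_act rho u^-1%g (sym_act rho u f) = f.
Proof. by rewrite -sym_act_act mulVg sym_act1. Qed.

Lemma sym_act_divdiff u a f : is_root rho a ->
  sym_act rho u (divdiff S rho a f) = divdiff S rho (rho u *m a) (sym_act rho u f).
Proof.
move=> ra; have rua := is_root_rho u ra; apply: (linform_inj rua).
rewrite divdiffE // -sym_act_linform -sym_actM divdiffE // sym_actB.
rewrite (root_refl_rho geo m3 u ra) (sym_act_act (u * T a)%g u^-1%g) sym_actK.
by rewrite (sym_act_act u (T a)).
Qed.

Lemma divdiffN a f : is_root rho a -> divdiff S rho (- a) f = - divdiff S rho a f.
Proof.
move=> ra; have rNa := is_rootN geo ra; apply: (linform_inj rNa).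
by rewrite divdiffE // (root_reflN geo m3) // linformN mulrNN divdiffE.
Qed.

(** Here u_i, D_1, D_2, D_3 stand for divided differences of f, d_1 d_3 f, d_3 d_2 f,
    d_2 d_1 f, while f_i = t_i f and g is the image of f under the common product
    t_1 t_3 = t_3 t_2 = t_2 t_1. Stating the relation in an abstract domain keeps the
    computation away from polynomials. *)
Lemma divided_difference_relation (A : idomainType)
    (L1 L2 L3 f f1 f2 f3 g u1 u2 u3 t1u3 t3u2 t2u1 D1 D2 D3 : A) :
  L1 != 0 -> L2 != 0 -> L3 != 0 -> L2 = L1 + L3 ->
  L1 * u1 = f - f1 -> L2 * u2 = f - f2 -> L3 * u3 = f - f3 ->
  L2 * t1u3 = f1 - g -> L1 * t3u2 = f3 - g -> - L3 * t2u1 = f2 - g ->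
  L1 * D1 = u3 - t1u3 -> L3 * D2 = u2 - t3u2 -> L2 * D3 = u1 - t2u1 ->
  D1 - D2 = D3.
Proof.
move=> L10 L20 L30 LE h1 h2 h3 k1 k3 k2 d1 d2 d3.
have L0 : L1 * L2 * L3 != 0 by rewrite !mulf_neq0.
apply: (mulfI L0).
have -> : L1 * L2 * L3 * (D1 - D2) = L2 * L3 * (L1 * D1) - L1 * L2 * (L3 * D2) by ring.
have -> : L1 * L2 * L3 * D3 = L1 * L3 * (L2 * D3) by ring.
rewrite d1 d2 d3.
have -> : L2 * L3 * (u3 - t1u3) - L1 * L2 * (u2 - t3u2) =
  L2 * (L3 * u3) - L3 * (L2 * t1u3) - L1 * (L2 * u2) + L2 * (L1 * t3u2) by ring.
have -> : L1 * L3 * (u1 - t2u1) = L3 * (L1 * u1) + L1 * (- L3 * t2u1) by ring.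
by rewrite h1 h2 h3 k1 k2 k3 LE; ring.
Qed.

(** The relation d_ab d_bc + d_bc d_ca + d_ca d_ab = 0 of Fomin and Kirillov, written
    with positive roots. *)
Lemma divdiff_relation b1 b2 b3 f :
  is_root rho b1 -> is_root rho b2 -> is_root rho b3 -> b2 = b1 + b3 ->
  divdiff S rho b1 (divdiff S rho b3 f) - divdiff S rho b3 (divdiff S rho b2 f) =
  divdiff S rho b2 (divdiff S rho b1 f).
Proof.
move=> r1 r2 r3 E.
have [e1 e3 e2] := root_triple geo r1 r2 r3 E.
have [g13 g21 _] := root_triple_refl geo m3 r1 r2 r3 E.
pose s (a : 'cV[R]_n) f := sym_act rho (T a) f.
have L0 a : is_root rho a -> linform a != 0.
  by move=> /is_root_neq0; apply: contra => /eqP/linform_eq0/eqP.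
apply: (@divided_difference_relation _ (linform b1) (linform b2) (linform b3)
  f (s b1 f) (s b2 f) (s b3 f) (sym_act rho (T b1 * T b3)%g f)
  (divdiff S rho b1 f) (divdiff S rho b2 f) (divdiff S rho b3 f)
  (s b1 (divdiff S rho b3 f)) (s b3 (divdiff S rho b2 f)) (s b2 (divdiff S rho b1 f)));
  rewrite ?L0 ?divdiffE //.
- by rewrite E linformD.
- by rewrite -{1}e1 -sym_act_linform -sym_actM divdiffE // sym_actB sym_act_act.
- by rewrite -{1}e3 -sym_act_linform -sym_actM divdiffE // sym_actB g13 sym_act_act.
- by rewrite -linformN -e2 -sym_act_linform -sym_actM divdiffE // sym_actB -g21 sym_act_act.
Qed.

Lemma coinv_repr (x : coinv rho) : exists f, x = \pi_(coinv rho) f.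
Proof. by exists (repr x); rewrite reprK. Qed.

Lemma coinv_act_act u v (x : coinv rho) : act (u * v)%g x = act u (act v x).
Proof.
have [f ->] := coinv_repr x.
by rewrite (coinv_act_pi rho v) (coinv_act_pi rho u) (coinv_act_pi rho (u * v)%g) sym_act_act.
Qed.

Lemma coinv_act1 (x : coinv rho) : act 1%g x = x.
Proof. by have [f ->] := coinv_repr x; rewrite coinv_act_pi sym_act1. Qed.

Lemma coinv_actD u (x y : coinv rho) : act u (x + y) = act u x + act u y.
Proof.
have [f ->] := coinv_repr x; have [g ->] := coinv_repr y.
rewrite -[\pi f + \pi g]raddfD (coinv_act_pi rho u f) (coinv_act_pi rho u g).
rewrite (coinv_act_pi rho u (f + g)) -[RHS]raddfD; congr (\pi _).
by rewrite /sym_act [LHS]raddfD.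
Qed.

Lemma coinv_act_dd u a (x : coinv rho) : is_root rho a ->
  act u (dd a x) = dd (rho u *m a) (act u x).
Proof.
move=> ra; have rua := is_root_rho u ra; have [f ->] := coinv_repr x.
rewrite (coinv_dd_pi f geo ra) (coinv_act_pi rho u f) (coinv_act_pi rho u).
by rewrite (coinv_dd_pi _ geo rua) sym_act_divdiff.
Qed.

Lemma coinv_dd_relation b1 b2 b3 (x : coinv rho) :
  is_root rho b1 -> is_root rho b2 -> is_root rho b3 -> b2 = b1 + b3 ->
  dd (- b3) (dd b2 x) + dd b1 (dd b3 x) = dd b2 (dd b1 x).
Proof.
move=> r1 r2 r3 E; have rN3 := is_rootN geo r3; have [f ->] := coinv_repr x.
rewrite !(coinv_dd_pi f geo) // (coinv_dd_pi _ geo rN3) (coinv_dd_pi _ geo r1).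
rewrite (coinv_dd_pi _ geo r2) -(divdiff_relation _ r1 r2 r3 E) divdiffN //.
by rewrite -[LHS]raddfD; congr (\pi _); apply: addrC.
Qed.

(** The form taken by a word with two divided differences and group elements
    between and behind them. *)
Lemma coinv_act_dd2 u v a b (x : coinv rho) : is_root rho a -> is_root rho b ->
  act (u * v)%g (dd (rho (u * v)^-1%g *m a) (dd (rho v^-1%g *m b) x)) =
  dd a (act u (dd b (act v x))).
Proof.
move=> ra rb; have ra' := is_root_rho (u * v)^-1%g ra; have rb' := is_root_rho v^-1%g rb.
by rewrite (coinv_act_dd _ _ ra') rhoKV coinv_act_act (coinv_act_dd v _ rb') rhoKV.
Qed.

(** * Words with two omitted letters *)

Section Word.
Variables (k : nat) (t : k.-tuple 'I_n).
Implicit Types (r : seq 'I_k) (J : {set 'I_k}).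
Local Notation letters r := (map (tnth t) r).

Definition dd_letter J (j : 'I_k) : coinv rho -> coinv rho :=
  if j \in J then act (S (tnth t j)) else dd (e (tnth t j)).

Lemma index_enumE : index_enum 'I_k = enum 'I_k.
Proof. by rewrite [index_enum _]unlock enumT. Qed.

Lemma dd_wordE J (x : coinv rho) : dd_word S t J x = foldr (dd_letter J) x (enum 'I_k).
Proof.
rewrite /dd_word index_enumE; elim: (enum _) => [|j r IH].
  by rewrite big_nil.
by rewrite big_cons /= IH.
Qed.

Lemma foldr_act J r (x : coinv rho) : {subset r <= J} ->
  foldr (dd_letter J) x r = act (eval (letters r)) x.
Proof.
elim: r => [|j r IH] rJ; first by rewrite word_eval_nil coinv_act1.
rewrite /= IH => [|i ir]; last by rewrite rJ // inE ir orbT.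
by rewrite word_eval_cons coinv_act_act /dd_letter rJ // mem_head.
Qed.

Lemma enum_split (p q : 'I_k) : (p < q)%N ->
  exists r1 r2 r3, [/\ enum 'I_k = r1 ++ p :: r2 ++ q :: r3,
    letters r1 = take p t, letters r2 = take (q - p.+1) (drop p.+1 t) &
    letters r3 = drop q.+1 t].
Proof.
move=> pq; pose E := enum 'I_k.
exists (take p E), (take (q - p.+1) (drop p.+1 E)), (drop q.+1 E).
have mE : letters E = t by rewrite map_tnth_enum.
split; rewrite ?map_take ?map_drop ?mE //.
have nE (i : 'I_k) : nth p E i = i by apply: nth_ord_enum.
rewrite -{1}(cat_take_drop p (enum _)) (drop_nth p) ?size_enum_ord // nE; congr (_ ++ _ :: _).
rewrite -{1}(cat_take_drop (q - p.+1) (drop p.+1 E)) drop_drop subnK //.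
by rewrite (drop_nth p (n := q)) ?size_enum_ord // nE.
Qed.

Lemma omit2_subset (p q : 'I_k) r1 r2 r3 :
  enum 'I_k = r1 ++ p :: r2 ++ q :: r3 -> forall r, r \in [:: r1; r2; r3] ->
  {subset r <= ~: [set p; q]}.
Proof.
move=> E; have := enum_uniq 'I_k.
have perm : perm_eq (enum 'I_k) (p :: q :: r1 ++ r2 ++ r3).
  by rewrite E; apply/seq.permP => a; rewrite /= !count_cat /= !count_cat /=; lia.
rewrite (seq.perm_uniq perm).
rewrite /= !inE => /and3P[/norP[_ pr] qr _] r rE i ir.
have ir' : i \in r1 ++ r2 ++ r3.
  by move: rE; rewrite !inE !mem_cat => /or3P[] /eqP <-; rewrite ir ?orbT.
by rewrite !inE; apply/norP; split; apply: contraTneq ir' => ->.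
Qed.

Lemma prod_omit2 (p q : 'I_k) : (p < q)%N ->
  (\prod_(j in ~: [set p; q]) S (tnth t j))%g =
  eval (take p t ++ take (q - p.+1) (drop p.+1 t) ++ drop q.+1 t).
Proof.
move=> pq; have [r1 [r2 [r3 [E <- <- <-]]]] := enum_split pq.
have sub := omit2_subset E.
have fE r : r \in [:: r1; r2; r3] -> filter (mem (~: [set p; q])) r = r.
  by move=> rr; apply/all_filterP/allP => i /(sub _ rr).
rewrite -!map_cat /word_eval big_map -[LHS]big_filter index_enumE E filter_cat /= filter_cat /= !inE !eqxx ?orbT /= !fE ?inE ?eqxx ?orbT //.
Qed.

Lemma dd_word_omit2 (p q : 'I_k) (x : coinv rho) : (p < q)%N ->
  let v := eval (take p t ++ take (q - p.+1) (drop p.+1 t) ++ drop q.+1 t) in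
  let u2 := eval (take (q - p.+1) (drop p.+1 t) ++ drop q.+1 t) in
  let u3 := eval (drop q.+1 t) in
  dd_word S t (~: [set p; q]) x =
  act v (dd (rho u2^-1%g *m e (tnth t p)) (dd (rho u3^-1%g *m e (tnth t q)) x)).
Proof.
move=> pq /=; have [r1 [r2 [r3 [E <- <- <-]]]] := enum_split pq.
have sub := omit2_subset E.
rewrite dd_wordE E foldr_cat /= foldr_cat /= !foldr_act; try by apply: sub; rewrite !inE eqxx ?orbT.
rewrite /dd_letter !inE !eqxx ?orbT /= -!map_cat.
rewrite map_cat !word_eval_cat map_cat word_eval_cat.
rewrite (coinv_act_act (eval (letters r1))) coinv_act_dd2 //; exact: is_root_simple.
Qed.
End Word.
End Operators.

(** * The skew operator of an interval of length two *)

Section Main.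
Variables (gT : finGroupType) (n : nat) (S : coxeter_system gT n).
Variables (R : realType) (rho : mx_representation R [set: gT] n).
Hypothesis geo : geometric_rep S rho.
Hypothesis m3 : forall i j : 'I_n, (cox_m S i j <= 3)%N.
Local Notation len := (cox_len S).
Local Notation eval := (word_eval S).
Local Notation e := (simple_root R).
Local Notation T := (root_refl S rho).
Local Notation dd a := (@coinv_dd _ _ S _ rho a).
Local Notation act u := (@coinv_act _ _ _ rho u).
Implicit Types (u v w x y : gT) (l : seq 'I_n).

Definition omit2 l p q := take p l ++ take (q - p.+1) (drop p.+1 l) ++ drop q.+1 l.

(** Erasing one letter and then another erases two letters at once; the second position
    shifts by one if it lies behind the first. *)
Lemma omit_omit l m m' : (m < size l)%N -> (m' < (size l).-1)%N ->
  let l' := take m l ++ drop m.+1 l in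
  exists p q, (p < q < size l)%N /\ take m' l' ++ drop m'.+1 l' = omit2 l p q.
Proof.
move=> ml m'l l'; have st : size (take m l) = m by rewrite size_takel // ltnW.
have [mm'|m'm] := leqP m m'.
  exists m, m'.+1; split; first by lia.
  rewrite /l' /omit2 take_cat drop_cat st ltnNge mm' /= ltnNge (leq_trans mm') //=.
  by rewrite -catA subSS drop_drop (_ : m'.+1 - m + m.+1 = m'.+2)%N //; lia.
exists m', m; split; first by lia.
rewrite /l' /omit2 take_cat drop_cat st m'm take_takel; last exact: ltnW.
rewrite take_drop subnK //; move: m'm; rewrite leq_eqVlt => /predU1P[<-|->] //.
by rewrite ltnn subnn drop0 [drop _ (take _ _)]drop_oversize // size_take_min geq_minl.

Qed.

Lemma bruhat_path x s :
  path [rel x y | [exists t, is_reflection S t && (y == (x * t)%g)] && (len x < len y)%N] x s ->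
  (len x + size s <= len (last x s))%N.
Proof.
elim: s x => [|y s IH] x /=; first by rewrite addn0.
by case/andP=> /andP[_ xy] /IH; apply: leq_trans; rewrite addnS -addSn leq_add2r.
Qed.

Variable i0 : 'I_n.
Local Notation beta := (inv_root S rho i0).

(** A chain from v to the element of l strictly increases the length, hence has one or
    two steps, and one step would change the parity of the length. *)
Lemma bruhat_omit2 v l : reduced S l -> bruhat S v (eval l) ->
  len (eval l) = (len v + 2)%N ->
  exists p q, (p < q < size l)%N /\ v = eval (omit2 l p q).
Proof.
move=> /eqP lenl /connectP[s sP wE] lenw.
have := bruhat_path sP; rewrite -wE lenw leq_add2l.
have mulK x y t : is_reflection S t -> y = (x * t)%g -> x = (y * t)%g.
  case/(pos_reflection geo m3) => a [ra _ ->] ->.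
  by rewrite -mulgA root_refl_mulgg // mulg1.
case: s sP wE => [|x [|y []]] //= sP wE.
- by move: lenw; rewrite wE; lia.
- move: sP; rewrite -wE => /andP[/andP[/existsP[t /andP[rt /eqP wt]] _] _].
  by have := len_parity v rt; rewrite -wt lenw oddD addbF; case: odd.
move: sP; rewrite -wE andbT.
case/andP=> /andP[/existsP[t /andP[rt /eqP xt]] vx] /andP[/existsP[t' /andP[rt' /eqP wt']] xw] _.
have xE := mulK _ _ _ rt' wt'; have vE := mulK _ _ _ rt xt.
rewrite xE in xw.
have [m ml E] := strong_exchange geo m3 i0 rt' xw.
rewrite -xE in E; rewrite vE E in vx.
have [m' m'l E'] := strong_exchange geo m3 i0 rt vx.
have m'l2 : (m' < (size l).-1)%N by move: m'l; rewrite size_cat size_takel ?size_drop; lia.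
have [p [q [pq eqO]]] := omit_omit ml m'l2.
by exists p, q; split=> //; rewrite vE E E' eqO.
Qed.


Lemma omit2_eval l p q : (p < q < size l)%N ->
  (eval l * T (beta l p) * T (beta l q))%g = eval (omit2 l p q).
Proof.
case/andP=> pq ql; rewrite inv_root_refl // ?(ltn_trans pq) //.
rewrite root_refl_rho ?root_refl_simple //; last exact: is_root_simple.
rewrite (drop_split i0 pq ql) cat_rcons !word_eval_cat word_eval_cons invgK -!mulgA.
by rewrite mulKVg (mulgA (S _)) gen_mulgg mul1g.
Qed.

Lemma inv_root_omit l p q : (p < q < size l)%N ->
  rho (T (beta l q)) *m beta l p =
  rho (eval (take (q - p.+1) (drop p.+1 l) ++ drop q.+1 l))^-1%g *m e (nth i0 l p).
Proof.
case/andP=> pq ql; rewrite {2}/inv_root -rhoM; congr (rho _ *m _).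
rewrite root_refl_rho ?root_refl_simple //; last exact: is_root_simple.
have := drop_split i0 pq ql; set mid := take _ _ => ->; rewrite cat_rcons !word_eval_cat word_eval_cons invgK !invMg.
by rewrite -!mulgA mulKVg gen_invg (mulgA (S _)) gen_mulgg mul1g.
Qed.

Lemma skew_dd_factors v w : bruhat S v w -> len w = (len v + 2)%N ->
  exists alpha gamma : 'cV[R]_n,
    [/\ pos_root rho alpha, pos_root rho gamma, alpha <> gamma &
      forall x : coinv rho, skew_dd S v w x = dd alpha (dd gamma x)].
Proof.
move=> vw lenw; set t := redexpr S w.
have tE : eval t = w by apply/eqP; apply: (xchooseP (redexpr_ex S w)).
have redt : reduced S t by rewrite /reduced tE size_tuple.
have st : size t = len w by rewrite size_tuple.
rewrite -tE in vw; have := bruhat_omit2 redt vw; rewrite tE => /(_ lenw)[p0 [q0 [pq0 vE0]]].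
rewrite -omit2_eval // tE in vE0.
pose k := len w.
pose cond (J : {set 'I_k}) :=
  ((\prod_(j in J) S (tnth t j))%g == v) && (#|J| == len v).
have bnd (p q : 'I_k) : (p < q)%N -> (p < q < size t)%N.
  by move=> pq; rewrite pq st; apply: ltn_ord.
have card2 (p q : 'I_k) : (p < q)%N -> #|~: [set p; q]| = len v.
  move=> pq; have := cardsC [set p; q]; rewrite cards2 card_ord -val_eqE /=.
  by rewrite neq_ltn pq => h; apply/eqP; rewrite -(eqn_add2l 2) h addnC; apply/eqP.
have condE (p q : 'I_k) : (p < q)%N ->
    cond (~: [set p; q]) = ((w * T (beta t p) * T (beta t q))%g == v).
  move=> pq; rewrite /cond card2 // eqxx andbT prod_omit2 //.
  by rewrite -[X in eval X]/(omit2 t p q) -omit2_eval ?bnd // tE.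
have condP J : cond J -> exists p q : 'I_k, (p < q)%N /\ J = ~: [set p; q].
  case/andP=> _ /eqP cJ; have : #|~: J| == 2%N.
    rewrite -(eqn_add2l (len v)) -{1}cJ cardsC card_ord; exact/eqP.
  case/cards2P=> p [q [pq JE]]; have {}JE : J = ~: [set p; q] by rewrite -JE finset.setCK.
  move: pq; rewrite -val_eqE neq_ltn => /orP[pq|qp]; first by exists p, q.
  by exists q, p; split; rewrite // finset.setUC.
have wordE (p q : 'I_k) (x : coinv rho) : (p < q)%N -> cond (~: [set p; q]) ->
    dd_word S t (~: [set p; q]) x =
    act v (dd (rho (T (beta t q)) *m beta t p) (dd (beta t q) x)).
  move=> pq; rewrite (condE _ _ pq) => /eqP vE; have bn := bnd _ _ pq.
  have oE : eval (omit2 t p q) = v by rewrite -omit2_eval // tE.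
  rewrite (dd_word_omit2 geo m3 t x pq) (inv_root_omit bn) -/(omit2 t p q) oE.
  by rewrite /inv_root !(tnth_nth i0).
have skewE (x : coinv rho) : skew_dd S v w x = act v^-1%g (\sum_(J | cond J) dd_word S t J x) by [].
have rb m : is_root rho (beta t m) by apply: inv_root_is_root.
have b0 m : (m < size t)%N -> nonneg (beta t m) by apply: inv_root_ge0.
have actK (y : coinv rho) : act v^-1%g (act v y) = y by rewrite -coinv_act_act mulVg coinv_act1.
have [[p [q [[pq pqE] f0 uniq]]]|[p [q [r [[pq pqE] [qr qrE] E _ uniq]]]]] :=
    pairs_dichotomy geo m3 i0 redt pq0.
- have /andP[pq' ql] := pq; rewrite st in ql; have pl := ltn_trans pq' ql.
  pose P := Ordinal pl; pose Q := Ordinal ql.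
  have condPQ : cond (~: [set P; Q]) by rewrite condE // -mulgA pqE mulgA -vE0.
  exists (rho (T (beta t q)) *m beta t p), (beta t q); split.
  + by split=> //; apply: is_root_rho.
  + by split=> //; apply: b0; rewrite st.
  + move/(congr1 (mulmx (rho (T (beta t q))))); rewrite -rhoM root_refl_mulgg // rho1.
    rewrite root_reflE // (cox_form_root geo) // mulr1 scaler_nat mulr2n opprD addNKr.
    by apply: nonneg_root_neqN => //; apply: b0; rewrite st.
  move=> x; rewrite skewE (big_pred1 (~: [set P; Q])); first by rewrite wordE.
  move=> J; apply/idP/eqP => [cJ|-> //]; have [P' [Q' [PQ' JE]]] := condP J cJ.
  move: cJ; rewrite JE condE // => /eqP; rewrite vE0 -!mulgA => /mulgI TE.
  have [] := uniq P' Q'; first by rewrite bnd.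
  by move=> h1 h2; congr (~: [set _; _]); apply: val_inj.
have /andP[pq' ql] := pq; have /andP[qr' rl] := qr; rewrite st in ql rl.
have pl := ltn_trans pq' ql.
pose P := Ordinal pl; pose Q := Ordinal ql; pose Q3 := Ordinal rl.
have condPQ : cond (~: [set P; Q]) by rewrite condE // -mulgA pqE mulgA -vE0.
have condQR : cond (~: [set Q; Q3]) by rewrite condE // -mulgA qrE mulgA -vE0.
exists (beta t q), (beta t p); split.
- by split=> //; apply: b0; rewrite st.
- by split=> //; apply: b0; rewrite st.
- by move/(inv_root_inj geo m3 redt); rewrite st => /(_ ql pl) qp; move: pq'; rewrite qp ltnn.
have neq : ~: [set Q; Q3] != ~: [set P; Q].
  apply/eqP => /setP/(_ P); rewrite !inE -!val_eqE /= eqxx.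
  by rewrite (ltn_eqF pq') (ltn_eqF (ltn_trans pq' qr')).
have [_ e3 e2] := root_triple geo (rb p) (rb q) (rb r) E.
move=> x; rewrite skewE (bigD1 (~: [set P; Q])) //= (big_pred1 (~: [set Q; Q3])).
  by rewrite !wordE // -coinv_actD actK /= e2 e3 (coinv_dd_relation geo m3 _ (rb p) (rb q) (rb r)).
move=> J; apply/idP/eqP => [/andP[cJ JPQ]|->]; last by rewrite condQR.
have [P' [Q' [PQ' JE]]] := condP J cJ.
move: cJ; rewrite JE condE // => /eqP; rewrite vE0 -!mulgA => /mulgI TE.
have [] := uniq P' Q'; first by rewrite bnd.
  by case=> h1 h2; case/eqP: JPQ; rewrite JE; congr (~: [set _; _]); apply: val_inj.
by case=> h1 h2; congr (~: [set _; _]); apply: val_inj.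
Qed.

End Main.

Theorem theorem1p13 (gT : finGroupType) (n : nat) (S : coxeter_system gT n)
    (R : realType) (rho : mx_representation R [set: gT] n)
    (hrho : geometric_rep S rho) (hW : simply_laced_weyl S)
    (v w : gT) (hvw : bruhat S v w) (hl : cox_len S w = (cox_len S v + 2)%N) :
  exists alpha gamma : 'cV[R]_n,
    [/\ pos_root rho alpha, pos_root rho gamma, alpha <> gamma &
      forall x : coinv rho,
        skew_dd S v w x = coinv_dd S alpha (coinv_dd S gamma x)].
Proof.
case: hW => [[n0 _] m3].
exact: (skew_dd_factors hrho m3 (Ordinal n0) hvw hl).
Qed.
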